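(* Let $\hat G$ be a topological group (not necessarily Hausdorff), $G$ a topological subgroup of $\hat G$, $Q$ a locally compact Hausdorff group, and let $1\to G\to\hat G\xrightarrow{q}Q\to1$ be an exact sequence of abstract groups ($q$ is not assumed continuous). Let $\Lambda$ be a discrete subgroup of $Q$ admitting a group homomorphism $s_1\colon\Lambda\to\hat G$ with $q\circ s_1=\mathrm{id}_\Lambda$. Assume there is a relatively compact strict fundamental domain $B$ for the action of $\Lambda$ on $Q$ by left multiplication such that $B=\coprod_{i=1}^pB^i$ is a finite partition into Borel sets and, for each $i$, there is a continuous map $\bar s_2^i\colon\overline{B^i}\to\hat G$ with $q\circ\bar s_2^i=\mathrm{id}_{\overline{B^i}}$ (closure taken in $Q$). Then for every $\hat G$-quasi-invariant continuous quasimorphism $\phi\colon G\to\mathbb{R}$ there exists a quasimorphism $\hat\phi\colon\hat G\to\mathbb{R}$ with $\hat\phi|_G=\phi$ and $D(\hat\phi)\le D(\phi)+3D'(\phi)$.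
   Context: A quasimorphism on a group $G$ is $\phi\colon G\to\mathbb{R}$ with defect $D(\phi)=\sup_{x,y\in G}|\phi(xy)-\phi(x)-\phi(y)|<\infty$. For a normal subgroup $G\trianglelefteq\hat G$, $\phi$ is $\hat G$-quasi-invariant if there is $D'\ge0$ with $|\phi(\hat gx\hat g^{-1})-\phi(x)|\le D'$ for all $\hat g\in\hat G$, $x\in G$; $D'(\phi)$ is the smallest such $D'$. A strict fundamental domain for the action is a subset of $Q$ meeting each $\Lambda$-orbit in exactly one point. *)

(* Defs.v *)
From HB Require Import structures.
From mathcomp Require Import all_boot all_order all_algebra.
From mathcomp Require Import all_classical all_reals all_analysis.
Set Implicit Arguments. Unset Strict Implicit. Unset Printing Implicit Defensive.
Import Order.TTheory GRing.Theory Num.Theory.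
Import numFieldNormedType.Exports.
Local Open Scope classical_set_scope.
Local Open Scope ring_scope.

Definition is_group {T : Type} (mul : T -> T -> T) (inv : T -> T) (one : T) : Prop :=
  [/\ forall x y z, mul x (mul y z) = mul (mul x y) z,
      forall x, mul one x = x /\ mul x one = x &
      forall x, mul (inv x) x = one /\ mul x (inv x) = one].

Definition is_topological_group {T : topologicalType}
  (mul : T -> T -> T) (inv : T -> T) (one : T) : Prop :=
  [/\ is_group mul inv one,
      continuous (fun p : T * T => mul p.1 p.2) &
      continuous inv].

Definition is_subgroup {T : Type} (mul : T -> T -> T) (inv : T -> T) (one : T)
  (H : set T) : Prop :=
  [/\ H one, forall x y, H x -> H y -> H (mul x y) & forall x, H x -> H (inv x)].

Definition is_hom {T U : Type} (mulT : T -> T -> T) (mulU : U -> U -> U)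
  (f : T -> U) : Prop := forall x y, f (mulT x y) = mulU (f x) (f y).

Definition discrete_subset {T : topologicalType} (H : set T) : Prop :=
  forall x, H x -> exists U : set T, [/\ open U, U x & U `&` H = [set x]].

Definition strict_fundamental_domain {T : Type} (mul : T -> T -> T)
  (Lam B : set T) : Prop :=
  forall x, exists! b, B b /\ exists l, Lam l /\ b = mul l x.

Definition borel_set {T : topologicalType} (A : set T) : Prop :=
  <<s [set: T], open >> A.

Section QM.
Variables (R : realType) (T : Type) (mul : T -> T -> T) (inv : T -> T).

Definition defect (H : set T) (phi : T -> R) : R :=
  sup [set `|phi (mul x y) - phi x - phi y| | x in H & y in H].

Definition is_quasimorphism (H : set T) (phi : T -> R) : Prop :=
  exists D : R, forall x y, H x -> H y -> `|phi (mul x y) - phi x - phi y| <= D.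

(* hatG-quasi-invariance of phi : H -> R (H normal in T). *)
Definition is_quasi_invariant (H : set T) (phi : T -> R) : Prop :=
  exists D' : R, forall g x, H x -> `|phi (mul (mul g x) (inv g)) - phi x| <= D'.

Definition qi_defect (H : set T) (phi : T -> R) : R :=
  sup [set `|phi (mul (mul g x) (inv g)) - phi x| | g in [set: T] & x in H].
End QM.

(* Main.v *)
Require Import Defs.
From HB Require Import structures.
From mathcomp Require Import all_boot all_order all_algebra.
From mathcomp Require Import all_classical all_reals all_analysis.
From mathcomp Require Import ring lra.
Import Order.TTheory GRing.Theory Num.Theory.
Import numFieldNormedType.Exports.
Local Open Scope classical_set_scope.
Local Open Scope ring_scope.

(** Some translate of a set [closure (Bi i)] has interior points, because finitely
many of them cover a neighbourhood of the identity; so [q] has a continuous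
section on an open set, hence, by translation, near every point of [Q].  Gluing
these sections with [Lam]-equivariant continuous weights [W_i], which sum to 1,
gives for each [x] in [Gh] a continuous function on [Q]
  [f_x y = \sum_(i, j) W_i y * W_j (y * q x) * phi (tau_i y * x * (tau_j (y * q x))^-1)]
which quasi-invariance makes [Lam]-invariant up to [D'], while the telescoping
product inside [phi] makes [f_(x x') y - f_x y - f_x' (y * q x)] at most [D].
With [c] of compact support such that [\sum_(l in Lam) c (l * y) = 1], put
[phih x = J (c * f_x)], where [J] is a left Haar functional with [J c = 1], for
[x] outside [G], and [phih = phi] on [G].  As [Lam] is discrete and cocompact,
[J] is also right invariant, so replacing [f_x'] by its translate [f_x' (_ * q x)]
costs at most [D'].  The discrepancy between [phi x] and [J (c * f_x)] for [x]
in [G] never enters: among [x], [x'] and [x x'], either none, exactly one or all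
three lie in [G], and when exactly one does it is [phi] of a conjugate of that
element which comes out of the telescoping product; the total defect is at most
[D + 2 D']. *)

Set Implicit Arguments. Unset Strict Implicit.

(** * Groups, homomorphisms and topological groups *)

Section Group.
Variables (T : Type) (mul : T -> T -> T) (inv : T -> T) (one : T).
Hypothesis gT : is_group mul inv one.
Local Notation "x ** y" := (mul x y) (at level 40, left associativity).

Lemma gmulA x y z : x ** (y ** z) = x ** y ** z.
Proof. by case: gT. Qed.
Lemma gmul1 x : one ** x = x. Proof. by case: gT => _ /(_ x)[]. Qed.
Lemma gmulr1 x : x ** one = x. Proof. by case: gT => _ /(_ x)[]. Qed.
Lemma gmulV x : inv x ** x = one. Proof. by case: gT => _ _ /(_ x)[]. Qed.
Lemma gmulrV x : x ** inv x = one. Proof. by case: gT => _ _ /(_ x)[]. Qed.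
Lemma gmulK x y : x ** y ** inv y = x.
Proof. by rewrite -gmulA gmulrV gmulr1. Qed.
Lemma gmulKV x y : x ** inv y ** y = x.
Proof. by rewrite -gmulA gmulV gmulr1. Qed.
Lemma gKmul x y : inv x ** (x ** y) = y.
Proof. by rewrite gmulA gmulV gmul1. Qed.
Lemma gKVmul x y : x ** (inv x ** y) = y.
Proof. by rewrite gmulA gmulrV gmul1. Qed.
Lemma gmulI x y z : x ** y = x ** z -> y = z.
Proof. by move=> e; rewrite -[y](gKmul x) e gKmul. Qed.
Lemma gmulIr x y z : y ** x = z ** x -> y = z.
Proof. by move=> e; rewrite -[y](gmulK _ x) e gmulK. Qed.
Lemma ginv_eq x y : x ** y = one -> inv x = y.
Proof. by move=> e; apply: (@gmulI x); rewrite gmulrV e. Qed.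
Lemma ginvK x : inv (inv x) = x.
Proof. by apply: ginv_eq; rewrite gmulV. Qed.
Lemma ginvM x y : inv (x ** y) = inv y ** inv x.
Proof. by apply: ginv_eq; rewrite gmulA gmulK gmulrV. Qed.
Lemma ginv1 : inv one = one.
Proof. by apply: ginv_eq; rewrite gmul1. Qed.
End Group.

Section Hom.
Variables (T U : Type) (mulT : T -> T -> T) (invT : T -> T) (oneT : T).
Variables (mulU : U -> U -> U) (invU : U -> U) (oneU : U).
Hypotheses (gT : is_group mulT invT oneT) (gU : is_group mulU invU oneU).
Variable f : T -> U.
Hypothesis fM : is_hom mulT mulU f.

Lemma hom1 : f oneT = oneU.
Proof.
apply: (gmulI gU (x := f oneT)).
by rewrite -fM (gmul1 gT) (gmulr1 gU).
Qed.

Lemma homV x : f (invT x) = invU (f x).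
Proof. by apply/esym/(ginv_eq gU); rewrite -fM (gmulrV gT) hom1. Qed.
End Hom.

Section TopGroupCvg.
Variables (T : topologicalType) (mul : T -> T -> T) (inv : T -> T) (one : T).
Hypothesis tgT : is_topological_group mul inv one.
Local Notation "x ** y" := (mul x y) (at level 40, left associativity).

Lemma tg_group : is_group mul inv one. Proof. by case: tgT. Qed.

Lemma cvg_gmul {I : Type} {F : set_system I} {FF : Filter F} (f g : I -> T) a b :
  f x @[x --> F] --> a -> g x @[x --> F] --> b ->
  f x ** g x @[x --> F] --> a ** b.
Proof.
move=> fa gb; case: tgT => _ /(_ (a, b)) mulc _.
exact: (cvg_comp _ _ (cvg_pair fa gb) mulc).
Qed.

Lemma cvg_ginv {I : Type} {F : set_system I} {FF : Filter F} (f : I -> T) a :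
  f x @[x --> F] --> a -> inv (f x) @[x --> F] --> inv a.
Proof. by move=> fa; case: tgT => _ _ /(_ a) invc; exact: (cvg_comp _ _ fa invc). Qed.

Lemma continuous_gmull a : continuous (mul a).
Proof. by move=> x; apply: cvg_gmul; [exact: cvg_cst|exact: cvg_id]. Qed.

Lemma continuous_gmulr a : continuous (mul^~ a).
Proof. by move=> x; apply: cvg_gmul; [exact: cvg_id|exact: cvg_cst]. Qed.

Lemma continuous_ginv : continuous inv.
Proof. by case: tgT. Qed.

Lemma compact_gmul (A B : set T) : compact A -> compact B ->
  compact [set x ** y | x in A & y in B].
Proof.
move=> cA cB; rewrite [X in compact X](_ : _ = (fun p => p.1 ** p.2) @` (A `*` B)).
  apply: continuous_compact; last exact: compact_setX.
  by apply: continuous_subspaceT; case: tgT.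
apply/seteqP; split=> z.
  by move=> [x Ax [y By <-]]; exists (x, y).
by move=> [[x y] [/= Ax By] <-]; exists x => //; exists y.
Qed.

Lemma compact_ginv (A : set T) : compact A -> compact (inv @` A).
Proof.
move=> cA; apply: continuous_compact => //.
exact/continuous_subspaceT/continuous_ginv.
Qed.
End TopGroupCvg.

(** * Compactly supported functions *)

(** The lists extending a given list form a filter base. Along it a single centre is eventually
    listed, and near-covering compactness turns this local fact into one list good for all of [A];
    centres outside [A] are filtered out. *)
Lemma compact_seq_cover (T : topologicalType) (A : set T) (V : T -> set T) :
  compact A -> (forall x, A x -> nbhs x (V x)) ->
  exists2 r : seq T, forall z, z \in r -> A z &
    forall x, A x -> exists2 z, z \in r & V z x.
Proof.
move=> cA AV.
pose above (s0 : seq T) := [set s : seq T | {subset s0 <= s}].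
have FF : Filter (filter_from setT above).
  apply: filter_from_filter => [|s t _ _]; first by exists [::].
  by exists (s ++ t) => // u su; split=> z zs; apply: su; rewrite mem_cat zs ?orbT.
have [s _ /(_ s) sV] : \forall s \near filter_from setT above,
    forall x, A x -> exists2 z, z \in [seq z <- s | `[< A z >]] & V z x.
  apply: ((compact_near_coveringP A).1 cA _ _
    (fun s x => exists2 z, z \in [seq z <- s | `[< A z >]] & V z x) FF) => x Ax.
  exists (V x, above [:: x]).
    by split; [exact: AV|exists [:: x]].
  move=> [x' s] /= [Vx' xs]; exists x => //.
  by rewrite mem_filter (xs x) ?mem_head// andbT; apply/asboolP.
exists [seq z <- s | `[< A z >]] => [z|x Ax]; last exact: sV.
by rewrite mem_filter => /andP[/asboolP].
Qed.

Section Cc.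
Variables (R : realType) (Q : topologicalType).
Variables (mul : Q -> Q -> Q) (inv : Q -> Q) (one : Q).
Hypothesis tgQ : is_topological_group mul inv one.
Hypothesis hQ : hausdorff_space Q.
Hypothesis lcQ : locally_compact [set: Q].
Local Notation "x ** y" := (mul x y) (at level 40, left associativity).

Let gQ := tg_group tgQ.

Definition supported (K : set Q) (f : Q -> R) := forall x, ~ K x -> f x = 0.

Definition Cc (f : Q -> R) :=
  continuous f /\ exists2 K, compact K & supported K f.

Lemma CcD f g : Cc f -> Cc g -> Cc (fun x => f x + g x).
Proof.
move=> [cf [K cK Kf]] [cg [L cL Lg]]; split.
  by move=> x; apply: cvgD; [exact: cf|exact: cg].
exists (K `|` L); first exact: compactU.
by move=> x /not_orP[Kx Lx]; rewrite Kf// Lg// addr0.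
Qed.

Lemma CcMl (f g : Q -> R) : continuous f -> Cc g -> Cc (fun x => f x * g x).
Proof.
move=> cf [cg [L cL Lg]]; split.
  by move=> x; apply: cvgM; [exact: cf|exact: cg].
by exists L => // x Lx; rewrite Lg// mulr0.
Qed.

Lemma CcZ k g : Cc g -> Cc (fun x => k * g x).
Proof. by apply: CcMl => x; exact: cvg_cst. Qed.

Lemma CcB f g : Cc f -> Cc g -> Cc (fun x => f x - g x).
Proof.
move=> cf cg; rewrite [X in Cc X](_ : _ = (fun x => f x + -1 * g x)).
  by apply: CcD => //; exact: CcZ.
by apply/funext => x; rewrite mulN1r.
Qed.

Lemma Cc0 : Cc (fun=> 0).
Proof. by split; [move=> x; exact: cvg_cst|exists set0 => //; exact: compact0]. Qed.

Lemma Cc_sum (I : Type) (r : seq I) (F : I -> Q -> R) :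
  (forall i, Cc (F i)) -> Cc (fun x => \sum_(i <- r) F i x).
Proof.
move=> cF; elim: r => [|i r IH].
  rewrite [X in Cc X](_ : _ = (fun=> 0)); first exact: Cc0.
  by apply/funext => x; rewrite big_nil.
rewrite [X in Cc X](_ : _ = (fun x => F i x + \sum_(i <- r) F i x)).
  exact: CcD.
by apply/funext => x; rewrite big_cons.
Qed.

Lemma Cc_max0 f : Cc f -> Cc (fun x => Num.max (f x) 0).
Proof.
move=> [cf [K cK Kf]]; split.
  by move=> x; apply: continuous_max; [exact: cf|exact: cvg_cst].
by exists K => // x /Kf ->; rewrite maxxx.
Qed.

Lemma Cc_abs f : Cc f -> Cc (fun x => `|f x|).
Proof.
move=> [cf [K cK Kf]]; split.
  by move=> x; apply: cvg_norm; exact: cf.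
by exists K => // x /Kf ->; rewrite normr0.
Qed.

Lemma Cc_comp (h k : Q -> Q) f : continuous h -> continuous k -> cancel h k ->
  Cc f -> Cc (fun x => f (h x)).
Proof.
move=> ch ck hk [cf [K cK Kf]]; split.
  by move=> x; apply: (continuous_comp (ch x) (cf _)).
exists (k @` K).
  by apply: continuous_compact => //; exact: continuous_subspaceT.
move=> x kKx; apply: Kf => Khx; apply: kKx.
by exists (h x).
Qed.

Lemma CcL a f : Cc f -> Cc (fun x => f (a ** x)).
Proof.
apply: (@Cc_comp _ (mul (inv a))); try exact: (continuous_gmull tgQ).
by move=> x; exact: (gKmul gQ).
Qed.

Lemma CcR a f : Cc f -> Cc (fun x => f (x ** a)).
Proof.
apply: (@Cc_comp _ (mul^~ (inv a))); try exact: (continuous_gmulr tgQ).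
by move=> x; exact: (gmulK gQ).
Qed.

Lemma CcV f : Cc f -> Cc (fun x => f (inv x)).
Proof.
apply: (@Cc_comp _ inv); try exact: (continuous_ginv tgQ).
by move=> x; exact: (ginvK gQ).
Qed.

Lemma Cc_bounded f : Cc f -> exists2 M : R, 0 < M & forall x, `|f x| <= M.
Proof.
move=> [cf [K cK Kf]].
have : compact (f @` K) by apply: continuous_compact => //; exact: continuous_subspaceT.
move=> /compact_bounded[M [_ Mf]].
exists (`|M| + 1) => [|x]; first by rewrite ltr_wpDl.
have [Kx|nKx] := pselect (K x); last by rewrite Kf// normr0 addr_ge0.
apply: (Mf (`|M| + 1)); last by exists x.
by rewrite (le_lt_trans (ler_norm _))// ltrDl.
Qed.

Lemma lc_nbhs (a : Q) : exists C, [/\ nbhs a C, compact C & closed C].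
Proof.
have := @lcQ a I.
by rewrite withinET => -[V aV [cV clV]]; exists V.
Qed.

(** A locally compact Hausdorff space is completely regular. The point [a] is separated from the
    complement of the interior of [U] intersected with a compact neighbourhood, which makes the
    support compact as well. *)
Lemma Cc_bump (a : Q) (U : set Q) : nbhs a U -> exists f : Q -> R,
  [/\ Cc f, forall x, 0 <= f x <= 1, f a = 1 & forall x, f x != 0 -> U x].
Proof.
move=> aU; have [V [aV cV clV]] := lc_nbhs a.
set W := interior (U `&` V).
have cW : closed (~` W) by apply: open_closedC; exact: open_interior.
have Wa : ~ (~` W) a by apply; apply: filterI.
have /uniform_separatorP := @locally_compact_completely_regular Q R lcQ hQ a _ cW Wa.
move=> /(_ R)[h [ch h01 h0 h1]].
exists (fun x => 1 - h x).
have hW x : 1 - h x != 0 -> (U `&` V) x.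
  move=> hx; apply: interior_subset; apply: contrapT => nWx.
  by move/eqP: hx; apply; rewrite (h1 (h x)) ?subrr//; exists x.
split.
- split; first by move=> x; apply: cvgB; [exact: cvg_cst|exact: ch].
  exists V => // x nVx; apply/eqP; apply: contrapT => /negP/hW[_ Vx].
  exact: nVx.
- move=> x; have : `[0, 1]%classic (h x) by apply: h01; exists x.
  by rewrite /= in_itv/= => /andP[h0x h1x]; rewrite subr_ge0 h1x/= gerBl.
- by rewrite (h0 (h a)) ?subr0//; exists a.
- by move=> x /hW[].
Qed.

(** A tube lemma: joint continuity at the points of [{p0} x K] is made uniform by compactness of
    [K], and off [K] both values are 0. *)
Lemma near_uniform (P : topologicalType) (F : P -> Q -> R) (K : set Q) (p0 : P) (e : R) :
  0 < e -> compact K -> (forall p y, ~ K y -> F p y = 0) ->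
  (forall y, F p.1 p.2 @[p --> (p0, y)] --> F p0 y) ->
  \forall p \near p0, forall y, `|F p y - F p0 y| <= e.
Proof.
move=> e0 cK FK cF.
have cF0 y : F p0 p.2 @[p --> (p0, y)] --> F p0 y.
  have := cF y; move=> /cvgrPdist_lt h; apply/cvgrPdist_lt => d d0.
  have [[A B]/= [pA yB] AB] := h _ d0.
  exists ([set: P], B); first by split => //; exact: filterT.
  by move=> [p z]/= [_ Bz]; apply: (AB (p0, z)); split => //=; exact: nbhs_singleton.
have hK : \forall p \near p0, forall y, K y -> `|F p y - F p0 y| <= e.
  apply: ((compact_near_coveringP K).1 cK P (nbhs p0)
    (fun p y => `|F p y - F p0 y| <= e) _) => y Ky.
  have : F p.1 p.2 - F p0 p.2 @[p --> (p0, y)] --> F p0 y - F p0 y.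
    by apply: cvgB; [exact: cF|exact: cF0].
  rewrite subrr => /cvgr0Pnorm_le /(_ _ e0)[[A B]/= [pA yB] AB].
  exists (B, A) => //= -[z p]/= [Bz Ap].
  exact: (AB (p, z)).
apply: filterS hK => p hp y; have [Ky|nKy] := pselect (K y); first exact: hp.
by rewrite !FK// subrr normr0 ltW.
Qed.

Lemma Cc_unif (f : Q -> R) (e : R) : Cc f -> 0 < e ->
  \forall v \near one, forall y, `|f (y ** v) - f y| <= e.
Proof.
move=> [cf [K cK Kf]] e0.
have h : \forall v \near one, forall y, K y -> `|f (y ** v) - f y| <= e.
  apply: ((compact_near_coveringP K).1 cK Q (nbhs one)
    (fun v y => `|f (y ** v) - f y| <= e) _) => y Ky.
  have : f (p.1 ** p.2) - f p.1 @[p --> (y, one)] --> f (y ** one) - f y.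
    apply: cvgB.
      apply: (cvg_comp (fun p : Q * Q => p.1 ** p.2) f _ (cf (y ** one))).
      by apply: (cvg_gmul tgQ); [exact: cvg_fst|exact: cvg_snd].
    by apply: (cvg_comp fst f _ (cf y)); exact: cvg_fst.
  by rewrite (gmulr1 gQ) subrr => /cvgr0Pnorm_le /(_ _ e0).
(* This handles [y] outside [K] with [y ** v] in [K]: the estimate is used at the base point
   [y ** v] with shift [inv v]. *)
have h' : \forall v \near one, forall y, K y -> `|f (y ** inv v) - f y| <= e.
  have := cvg_ginv tgQ (@cvg_id _ (nbhs one)).
  by rewrite (ginv1 gQ) => /(_ _ _ h).
near=> v => y.
have [Ky|nKy] := pselect (K y); first exact: (near h v).
have [Kv|nKv] := pselect (K (y ** v)); last by rewrite !Kf// subrr normr0 ltW.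
by rewrite distrC -{1}[y](gmulK gQ y v); exact: (near h' v).
Unshelve. all: by end_near. Qed.

End Cc.

(** * Existence of a left Haar functional *)

Lemma ultra_fmap (T U : Type) (f : T -> U) (G : set_system T) :
  UltraFilter G -> UltraFilter (f x @[x --> G]).
Proof.
move=> UG; split=> [|H PH GH]; first exact: fmap_proper_filter.
apply/seteqP; split=> [A HA|]; last exact: GH.
have [//|GA] := in_ultra_setVsetC (f @^-1` A) UG.
have HnA : H (~` A) by apply: GH.
by have /filter_ex[x []] : H (A `&` ~` A) by exact: filterI.
Qed.

Section CoveringNumbers.
Variables (R : realType) (Q : topologicalType).
Variables (mul : Q -> Q -> Q) (inv : Q -> Q) (one : Q).
Hypothesis tgQ : is_topological_group mul inv one.
Local Notation "x ** y" := (mul x y) (at level 40, left associativity).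
Let gQ := tg_group tgQ.
Implicit Types (f g phi : Q -> R) (l : seq (R * Q)).

Definition Cp f := Cc f /\ forall x, 0 <= f x.

Lemma CpD f g : Cp f -> Cp g -> Cp (fun x => f x + g x).
Proof. by move=> [cf f0] [cg g0]; split=> [|x]; [exact: CcD|exact: addr_ge0]. Qed.

Lemma CpZ k f : 0 <= k -> Cp f -> Cp (fun x => k * f x).
Proof. by move=> k0 [cf f0]; split=> [|x]; [exact: CcZ|exact: mulr_ge0]. Qed.

Lemma CpL a f : Cp f -> Cp (fun x => f (a ** x)).
Proof. by move=> [cf f0]; split=> [|x//]; exact: (CcL tgQ). Qed.

Definition comb phi l (x : Q) := \sum_(p <- l) p.1 * phi (inv p.2 ** x).
Definition mass l : R := \sum_(p <- l) p.1.
Definition dominates phi l f :=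
  (forall p, p \in l -> 0 <= p.1) /\ forall x, f x <= comb phi l x.

Lemma mass_ge0 phi l f : dominates phi l f -> 0 <= mass l.
Proof. by move=> [l0 _]; rewrite /mass big_seq; apply: sumr_ge0 => p /l0. Qed.

Lemma dominates_ex f phi a : Cp f -> Cp phi -> 0 < phi a ->
  exists l, dominates phi l f.
Proof.
move=> [cf f0] [cphi phi0] phia.
have [M M0 fM] := Cc_bounded cf.
have [_ [K cK Kf]] := cf.
pose V y := [set x | phi a / 2 < phi (a ** inv y ** x)].
have [y Ky|r _ rV] := @compact_seq_cover _ K V cK.
  have : phi (a ** inv y ** x) @[x --> y] --> phi (a ** inv y ** y).
    apply: (cvg_comp (mul (a ** inv y)) phi _ (cphi.1 _)).
    exact: (continuous_gmull tgQ).
  move=> /cvgr_gt; apply.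
  by rewrite (gmulKV gQ) ltr_pdivrMr// ltr_pMr// ltr1n.
(* The translate by [y ** inv a] carries [a] to [y]. It exceeds [phi a / 2] on [V y], so the
   coefficient lifts it above the bound [M] of [f] there. *)
exists [seq (2 * M / phi a, y ** inv a) | y <- r]; split.
  by move=> p /mapP[y _ ->] /=; rewrite divr_ge0// ?mulr_ge0// ltW.
move=> x; have [Kx|nKx] := pselect (K x); last first.
  rewrite Kf// /comb big_map sumr_ge0// => y _ /=.
  by rewrite mulr_ge0// divr_ge0 ?mulr_ge0// ltW.
have [y yr Vyx] := rV _ Kx.
rewrite /comb big_map (perm_big _ (perm_to_rem yr)) big_cons/=.
rewrite (ginvM gQ) (ginvK gQ).
have := ler_norm (f x); move=> /le_trans; apply.
rewrite (le_trans (fM x))// -[leLHS]addr0 lerD//; last first.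
  by apply: sumr_ge0 => z _; rewrite mulr_ge0// divr_ge0 ?mulr_ge0// ltW.
rewrite -ler_pdivrMl ?divr_gt0 ?mulr_gt0//.
apply: ltW; apply: le_lt_trans Vyx.
by rewrite le_eqVlt; apply/orP; left; apply/eqP; field; rewrite !gt_eqF.
Qed.

(* Weil's covering number (f : phi); it is [inf set0 = 0] when no combination of
   translates of [phi] dominates [f]. *)
Definition cov f phi := inf [set mass l | l in [set l | dominates phi l f]].

Lemma cov_le f phi l : dominates phi l f -> cov f phi <= mass l.
Proof.
move=> lf; apply: ge_inf; last by exists l.
by exists 0 => _ [m mf <-]; exact: mass_ge0 mf.
Qed.

Lemma le_cov f phi b : (exists l, dominates phi l f) ->
  (forall l, dominates phi l f -> b <= mass l) -> b <= cov f phi.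
Proof.
move=> [l lf] h; apply: lb_le_inf; first by exists (mass l), l.
by move=> _ [m mf <-]; exact: h.
Qed.

Lemma cov_ge0 f phi : 0 <= cov f phi.
Proof.
have [h|h] := pselect (exists l, dominates phi l f).
  by apply: le_cov => // l; exact: mass_ge0.
rewrite /cov [X in inf X](_ : _ = set0) ?inf0//.
by apply/seteqP; split => // x [l lf _]; apply: h; exists l.
Qed.

(** The common pattern of the inequalities below: a recipe turning coverings into coverings passes
    to the infima. The case [c = 0] is separate because the argument divides by [c]. *)
Lemma cov_transfer f phi g psi c : 0 <= c -> (exists l, dominates phi l f) ->
  (forall l, dominates phi l f -> exists2 m, dominates psi m g & mass m <= c * mass l) ->
  cov g psi <= c * cov f phi.
Proof.
move=> c0 exl h.
have h' l : dominates phi l f -> cov g psi <= c * mass l.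
  by move=> /h[m mg]; apply: le_trans; exact: cov_le.
have [cE|cN] := eqVneq c 0.
  by have [l /h'] := exl; rewrite cE !mul0r.
have {}c0 : 0 < c by rewrite lt_neqAle eq_sym cN.
rewrite -ler_pdivrMl//; apply: le_cov => // l /h'.
by rewrite ler_pdivrMl.
Qed.

Section Fixed.
Variable phi : Q -> R.
Variable a : Q.
Hypotheses (phip : Cp phi) (phia : 0 < phi a).

Lemma cov_mono f g : Cp g -> (forall x, f x <= g x) -> cov f phi <= cov g phi.
Proof.
move=> gp fg; rewrite -[leRHS]mul1r.
apply: cov_transfer => // [|l [l0 lg]]; first exact: (dominates_ex gp phip phia).
exists l; last by rewrite mul1r.
by split => // x; exact: le_trans (fg x) (lg x).
Qed.

Lemma cov_scale k f : 0 <= k -> Cp f -> cov (fun x => k * f x) phi <= k * cov f phi.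
Proof.
move=> k0 fp; apply: cov_transfer => // [|l [l0 lf]].
  exact: (dominates_ex fp phip phia).
exists [seq (k * p.1, p.2) | p <- l]; last by rewrite /mass big_map mulr_sumr.
split=> [p /mapP[p' /l0 p'0 ->]|x]; first exact: mulr_ge0.
rewrite /comb big_map /=; under eq_bigr do rewrite -mulrA.
by rewrite -mulr_sumr ler_wpM2l//; exact: lf.
Qed.

Lemma cov_translate_le b f : Cp f -> cov (fun x => f (b ** x)) phi <= cov f phi.
Proof.
move=> fp; rewrite -[leRHS]mul1r; apply: cov_transfer => // [|l [l0 lf]].
  exact: (dominates_ex fp phip phia).
exists [seq (p.1, inv b ** p.2) | p <- l]; last by rewrite /mass big_map mul1r.
split=> [p /mapP[p' /l0 p'0 ->]//|x].
rewrite (le_trans (lf _))// /comb big_map /=.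
under [leRHS]eq_bigr do rewrite (ginvM gQ) (ginvK gQ) -(gmulA gQ).
by [].
Qed.

Lemma cov_translate b f : Cp f -> cov (fun x => f (b ** x)) phi = cov f phi.
Proof.
move=> fp; apply/eqP; rewrite eq_le cov_translate_le//=.
have := cov_translate_le (inv b) (CpL b fp).
by under eq_fun do rewrite (gKVmul gQ).
Qed.

Lemma covD_le f g : Cp f -> Cp g ->
  cov (fun x => f x + g x) phi <= cov f phi + cov g phi.
Proof.
move=> fp gp; rewrite -lerBlDr; apply: le_cov => [|l [l0 lf]].
  exact: (dominates_ex fp phip phia).
rewrite lerBlDr addrC -lerBlDr; apply: le_cov => [|m [m0 mg]].
  exact: (dominates_ex gp phip phia).
rewrite lerBlDr; have -> : mass m + mass l = mass (m ++ l).
  by rewrite /mass big_cat.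
apply: cov_le; split=> [p|x]; first by rewrite mem_cat => /orP[/m0|/l0].
by rewrite /comb big_cat/= [leRHS]addrC; apply: lerD; [exact: lf|exact: mg].
Qed.

(** A covering of [f0] is substituted into a covering of [f] by translates of [f0]. The resulting
    bound on the ratio of the two covering numbers does not depend on [phi], so limits of such
    ratios can be taken. *)
Lemma cov_trans f f0 l : Cp f0 -> dominates f0 l f ->
  cov f phi <= mass l * cov f0 phi.
Proof.
move=> f0p lf; apply: cov_transfer; first exact: mass_ge0 lf.
  exact: (dominates_ex f0p phip phia).
move: lf => [l0 lf] m [m0 mf0].
exists [seq (p.1 * r.1, p.2 ** r.2) | p <- l, r <- m]; last first.
  rewrite /mass big_allpairs_dep/= mulr_suml.
  by apply: ler_sum => p _; rewrite mulr_sumr.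
split=> [_ /allpairsP[[p r]/= [pl rm ->]]|x]; first by apply: mulr_ge0; [exact: l0|exact: m0].
rewrite (le_trans (lf x))// /comb big_allpairs_dep/= !big_seq.
apply: ler_sum => p /l0 p0.
under [leRHS]eq_bigr do rewrite (ginvM gQ) -(gmulA gQ) -mulrA.
by rewrite -mulr_sumr ler_wpM2l//; exact: mf0.
Qed.

(** If [M] bounds [phi], evaluating a covering at [b] shows that its mass is at least [f b / M]. *)
Lemma cov_gt0 f b : Cp f -> 0 < f b -> 0 < cov f phi.
Proof.
move=> fp fb; have [M M0 phiM] := Cc_bounded phip.1.
apply: (@lt_le_trans _ _ (f b / M)); first by rewrite divr_gt0.
apply: le_cov => [|l [l0 lf]]; first exact: (dominates_ex fp phip phia).
rewrite ler_pdivrMr// (le_trans (lf b))// /comb /mass mulr_suml !big_seq.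
apply: ler_sum => p /l0 p0; rewrite ler_wpM2l//.
exact: le_trans (ler_norm _) (phiM _).
Qed.
End Fixed.

End CoveringNumbers.

(** * Approximate additivity of covering numbers *)

Section NearAdditivity.
Variables (R : realType) (Q : topologicalType).
Variables (mul : Q -> Q -> Q) (inv : Q -> Q) (one : Q).
Hypothesis tgQ : is_topological_group mul inv one.
Hypothesis hQ : hausdorff_space Q.
Hypothesis lcQ : locally_compact [set: Q].
Local Notation "x ** y" := (mul x y) (at level 40, left associativity).
Let gQ := tg_group tgQ.
Implicit Types (f g phi : Q -> R) (l : seq (R * Q)).

(** Zeros of [h] outside [K] do no harm: [K] is closed, so the quotient vanishes in a neighbourhood
    of every point outside it. *)
Lemma Cc_div (f h : Q -> R) K : continuous f -> continuous h -> compact K ->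
  supported K f -> (forall x, K x -> h x != 0) -> Cc (fun x => f x / h x).
Proof.
move=> cf ch cK Kf hK; split; last by exists K => // x /Kf ->; rewrite mul0r.
move=> x; have [Kx|nKx] := pselect (K x).
  by apply: cvgM; [exact: cf|apply: cvgV; [exact: hK|exact: ch]].
have nK : \forall y \near x, ~ K y.
  apply: open_nbhs_nbhs; split => //.
  by apply: closed_openC; exact: compact_closed.
rewrite /continuous_at/= Kf// mul0r; apply: cvg_near_cst.
by apply: filterS nK => y /Kf ->; rewrite mul0r.
Qed.

(** Twice a bump exceeds 1 wherever the bump exceeds 1/2, and finitely many such neighbourhoods
    cover [K]. *)
Lemma Cp_ge1 (K : set Q) : compact K ->
  exists2 g : Q -> R, Cp g & forall x, K x -> 1 <= g x.
Proof.
move=> cK.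
have /choice[b bP] : forall y : Q, exists f : Q -> R, Cp f /\ f y = 1.
  move=> y; have [f [cf f01 fy _]] := Cc_bump R hQ lcQ (filterT : nbhs y setT).
  by exists f; split=> //; split=> // x; case/andP: (f01 x).
pose V y := [set x | 1 / 2 < b y x].
have [y Ky|r _ rV] := @compact_seq_cover _ K V cK.
  have [[[cb _] _] by1] := bP y.
  have /cvgr_gt := cb y; apply.
  by rewrite by1; lra.
exists (fun x => \sum_(y <- r) 2 * b y x).
  split; first by apply: Cc_sum => y; apply: CcZ; case: (bP y) => -[].
  by move=> x; apply: sumr_ge0 => y _; rewrite mulr_ge0//; case: (bP y) => -[].
move=> x /rV[y yr Vyx].
rewrite (perm_big _ (perm_to_rem yr)) big_cons/= -[leLHS]addr0 lerD//.
  by move: Vyx; rewrite /V/=; lra.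
by apply: sumr_ge0 => z _; rewrite mulr_ge0//; case: (bP z) => -[].
Qed.

(* Weights [f1 / h] and [f2 / h] split a covering of [h = f1 + f2 + e * g] into
   coverings of [f1] and [f2]; [e * g] keeps [h] away from 0 on the supports. *)
Lemma cov_near_add f1 f2 : Cp f1 -> Cp f2 -> exists2 g : Q -> R, Cp g &
  forall e : R, 0 < e -> exists2 U, nbhs one U &
  forall phi a, Cp phi -> 0 < phi a -> (forall x, phi x != 0 -> U x) ->
    cov mul inv f1 phi + cov mul inv f2 phi <=
    (1 + 2 * e) * (cov mul inv (fun x => f1 x + f2 x) phi + e * cov mul inv g phi).
Proof.
move=> f1p f2p.
have [[cf1 [K1 cK1 Kf1]] f10] := f1p.
have [[cf2 [K2 cK2 Kf2]] f20] := f2p.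
pose K := K1 `|` K2.
have cK : compact K by exact: compactU.
have {}Kf1 : supported K f1 by move=> x /not_orP[/Kf1].
have {}Kf2 : supported K f2 by move=> x /not_orP[_ /Kf2].
have [g gp g1] := Cp_ge1 cK; exists g => // e e0.
pose h x := f1 x + f2 x + e * g x.
have hp : Cp h by apply: CpD; [exact: CpD|apply: CpZ => //; exact: ltW].
have h_gt0 x : K x -> 0 < h x.
  move=> Kx; rewrite ltr_wpDl ?addr_ge0// mulr_gt0//.
  by rewrite (lt_le_trans _ (g1 _ Kx)).
have ch : continuous h by case: hp => -[].
have hN0 x : K x -> h x != 0 by move=> Kx; rewrite gt_eqF// h_gt0.
have ch1 : Cc (fun x => f1 x / h x) by exact: Cc_div Kf1 hN0.
have ch2 : Cc (fun x => f2 x / h x) by exact: Cc_div Kf2 hN0.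
exists [set v | (forall y, `|f1 (y ** v) / h (y ** v) - f1 y / h y| <= e) /\
                (forall y, `|f2 (y ** v) / h (y ** v) - f2 y / h y| <= e)].
  exact: (filterI (Cc_unif tgQ ch1 e0) (Cc_unif tgQ ch2 e0)).
move=> phi a phip phia Uphi.
have phi0 : forall x, 0 <= phi x by case: phip.
have hK f x : supported K f -> h x * (f x / h x) = f x.
  move=> Kf; have [Kx|nKx] := pselect (K x); last by rewrite Kf// mul0r mulr0.
  by rewrite mulrC divfK// hN0.
(* Each coefficient is scaled by the weight [f / h] at its translate. The extra [e] absorbs the
   variation of the weight on the support of that translate, so the scaled combination still
   dominates [f]. *)
pose part f l : seq (R * Q) := [seq (p.1 * (f p.2 / h p.2 + e), p.2) | p <- l].
have partP f l : Cp f -> supported K f ->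
    (forall x, phi x != 0 -> forall y, `|f (y ** x) / h (y ** x) - f y / h y| <= e) ->
    dominates mul inv phi l h -> dominates mul inv phi (part f l) f.
  move=> [_ f0] Kf Uf [l0 lh]; split=> [_ /mapP[p /l0 p0 ->]/=|x].
    apply: mulr_ge0 => //; apply: addr_ge0; last exact: ltW.
    by apply: divr_ge0 => //; case: hp.
  have fh0 : 0 <= f x / h x by apply: divr_ge0 => //; case: hp.
  rewrite -{1}(hK _ x Kf) (le_trans (ler_wpM2r fh0 (lh x)))//.
  rewrite /comb /part big_map mulr_suml !big_seq; apply: ler_sum => p /l0 p0/=.
  rewrite -!mulrA ler_wpM2l// [leRHS]mulrC.
  have [->|phiN0] := eqVneq (phi (inv p.2 ** x)) 0; first by rewrite !(mul0r, mulr0).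
  rewrite ler_wpM2l//.
  have := Uf _ phiN0 p.2; rewrite (gKVmul gQ) ler_norml => /andP[_].
  by rewrite lerBlDl.
have key : cov mul inv f1 phi + cov mul inv f2 phi <= (1 + 2 * e) * cov mul inv h phi.
  have e1 : 0 < 1 + 2 * e by lra.
  rewrite -ler_pdivrMl//; apply: le_cov => [|l lh].
    exact: (dominates_ex tgQ hp phip phia).
  rewrite ler_pdivrMl//.
  have l1 := partP f1 l f1p Kf1 (fun x px => (Uphi x px).1) lh.
  have l2 := partP f2 l f2p Kf2 (fun x px => (Uphi x px).2) lh.
  apply: (le_trans (lerD (cov_le l1) (cov_le l2))).
  (* The two scaling factors at [p.2] add up to at most [1 + 2 * e], because [f1 + f2 <= h]. *)
  rewrite /mass /part !big_map -big_split/= mulr_sumr !big_seq.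
  apply: ler_sum => p /lh.1 p0; rewrite -mulrDr mulrC ler_wpM2r//.
  rewrite addrACA -mulrDl (_ : e + e = 2 * e); last by ring.
  rewrite lerD2r.
  have [Kp|nKp] := pselect (K p.2); last by rewrite Kf1// Kf2// addr0 mul0r.
  rewrite ler_pdivrMr ?h_gt0// mul1r lerDl mulr_ge0 ?ltW//.
  by rewrite (lt_le_trans _ (g1 _ Kp)).
apply: (le_trans key); rewrite ler_wpM2l//; first by lra.
apply: (le_trans (covD_le tgQ phip phia (CpD f1p f2p) (CpZ (ltW e0) gp))).
by rewrite lerD2l; apply: (cov_scale tgQ phip phia) => //; exact: ltW.
Qed.

End NearAdditivity.

(** * The Haar functional as an ultrafilter limit *)

Section HaarFunctional.
Variables (R : realType) (Q : topologicalType).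
Variables (mul : Q -> Q -> Q) (inv : Q -> Q) (one : Q).
Hypothesis tgQ : is_topological_group mul inv one.
Hypothesis hQ : hausdorff_space Q.
Hypothesis lcQ : locally_compact [set: Q].
Local Notation "x ** y" := (mul x y) (at level 40, left associativity).
Implicit Types (f g phi : Q -> R) (l : seq (R * Q)).

(** [J] is total on functions, but only its values on [Cc] are constrained; the last clause excludes
    the zero functional. *)
Definition left_haar (J : (Q -> R) -> R) :=
  [/\ forall f g, Cc f -> Cc g -> J (fun x => f x + g x) = J f + J g,
      forall k f, Cc f -> J (fun x => k * f x) = k * J f,
      forall f g, Cc f -> Cc g -> (forall x, f x <= g x) -> J f <= J g,
      forall a f, Cc f -> J (fun x => f (a ** x)) = J f &
      exists2 f, Cc f & J f = 1].

Lemma cvg_le_near (T : Type) (F : set_system T) {PF : ProperFilter F}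
    (u v : T -> R) (a b : R) :
  u x @[x --> F] --> a -> v x @[x --> F] --> b ->
  (\forall x \near F, u x <= v x) -> a <= b.
Proof.
move=> ua vb uv; rewrite -subr_ge0.
apply: (@cvgr_to_ge _ F _ _ (fun x => v x - u x)); first exact: cvgB.
by apply: filterS uv => x; rewrite subr_ge0.
Qed.

(** Weil's construction: [J f] is the limit of [cov f phi / cov f0 phi] as the support of [phi]
    shrinks to the identity. Superadditivity appears only in the limit, through [cov_near_add]; the
    rest is inherited from the covering numbers. *)
Lemma left_haar_pos_ex : exists J : (Q -> R) -> R,
  [/\ forall f g, Cp f -> Cp g -> J (fun x => f x + g x) = J f + J g,
      forall k f, 0 <= k -> Cp f -> J (fun x => k * f x) <= k * J f,
      forall f g, Cp f -> Cp g -> (forall x, f x <= g x) -> J f <= J g,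
      forall a f, Cp f -> J (fun x => f (a ** x)) = J f &
      exists2 f, Cp f & J f = 1].
Proof.
have [f0 [cf0 f001 f0one _]] := Cc_bump R hQ lcQ (filterT : nbhs one setT).
have f0p : Cp f0 by split=> // x; case/andP: (f001 x).
have f0gt : 0 < f0 one by rewrite f0one.
have /choice[phi phiP] : forall U : set Q, exists phi : Q -> R, nbhs one U ->
    [/\ Cp phi, 0 < phi one & forall x, phi x != 0 -> U x].
  move=> U; have [oU|nU] := pselect (nbhs one U); last by exists f0.
  have [f [cf f01 fone fU]] := Cc_bump R hQ lcQ oU.
  exists f => _; split=> //; last by rewrite fone.
  by split=> // x; case/andP: (f01 x).
(* [G] refines the filter of shrinking neighbourhoods [U] of the identity; [phi U] is supported in
   [U]. *)
have [G [UG sG]] := ultraFilterLemma (powerset_filter_from_filter (nbhs_pfilter one)).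
have Gn : \forall U \near G, nbhs one U by apply: sG; exact: near_small_set.
have Gs V : nbhs one V -> \forall U \near G, U `<=` V.
  by move=> oV; apply: sG; exact: small_set_sub.
pose rho f U := cov mul inv f (phi U) / cov mul inv f0 (phi U).
have cov0 U : nbhs one U -> 0 < cov mul inv f0 (phi U).
  by move=> /phiP[pp p0 _]; exact: (cov_gt0 tgQ pp p0 f0p f0gt).
(* By [cov_trans] the ratio stays in the compact interval from 0 to [mass l], so it converges along
   the ultrafilter. *)
have /(@choice _ R)[J JP] : forall f, exists a : R, Cp f -> rho f U @[U --> G] --> a.
  move=> f; have [fp|nfp] := pselect (Cp f); last by exists 0.
  have [l lf] := dominates_ex tgQ fp f0p f0gt.
  have := @segment_compact R 0 (mass l); rewrite compact_ultra.
  move=> /(_ (rho f U @[U --> G]) (ultra_fmap _ UG))[|a [_ /= ra]]; last by exists a.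
  apply: filterS Gn => U oU; rewrite /= in_itv/= divr_ge0 ?cov_ge0//=.
  rewrite ler_pdivrMr ?cov0//; have [pp p0 _] := phiP _ oU.
  exact: (cov_trans tgQ pp p0 f0p lf).
exists J; split.
- move=> f g fp gp; apply/eqP; rewrite eq_le; apply/andP; split.
    apply: (cvg_le_near (JP _ (CpD fp gp)) (cvgD (JP _ fp) (JP _ gp))).
    apply: filterS Gn => U oU; have [pp p0 _] := phiP _ oU.
    rewrite -mulrDl ler_wpM2r ?invr_ge0 ?cov_ge0//.
    exact: (covD_le tgQ pp p0 fp gp).
  have [g1 g1p near_add] := cov_near_add tgQ hQ lcQ fp gp.
  set B := J (fun x => f x + g x); set C := J g1.
  have JB : rho (fun x => f x + g x) U @[U --> G] --> B by apply: JP; exact: CpD.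
  have B0 : 0 <= B.
    apply: (cvgr_to_ge JB); apply: filterS Gn => U oU.
    by rewrite divr_ge0 ?cov_ge0.
  have C0 : 0 <= C.
    apply: (cvgr_to_ge (JP _ g1p)); apply: filterS Gn => U oU.
    by rewrite divr_ge0 ?cov_ge0.
  have le_e e : 0 < e -> J f + J g <= (1 + 2 * e) * (B + e * C).
    move=> e0; have [V oV Vadd] := near_add e e0.
    apply: (@cvg_le_near _ G _ (fun U => rho f U + rho g U)
      (fun U => (1 + 2 * e) * (rho (fun x => f x + g x) U + e * rho g1 U))).
    - exact: cvgD (JP _ fp) (JP _ gp).
    - apply: cvgM; first exact: cvg_cst.
      by apply: cvgD => //; apply: cvgM; [exact: cvg_cst|exact: JP].
    - apply: filterS2 Gn (Gs _ oV) => U oU UV; have [pp p0 pU] := phiP _ oU.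
      rewrite /rho mulrA -!mulrDl mulrA ler_wpM2r ?invr_ge0 ?cov_ge0//.
      by apply: (Vadd _ _ pp p0) => x /pU/UV.
  apply/ler_addgt0Pr => d d0.
  (* For [e <= 1], [(1 + 2 * e) * (B + e * C)] exceeds [B] by at most [e * (2 * B + 3 * C)]; the
     added 1 keeps the denominator positive. *)
  pose e := Num.min 1 (d / (2 * B + 3 * C + 1)).
  have K0 : 0 < 2 * B + 3 * C + 1 by lra.
  have e0 : 0 < e by rewrite lt_min ltr01 divr_gt0.
  have e1 : e <= 1 by rewrite ge_min lexx.
  have ed : e * (2 * B + 3 * C + 1) <= d.
    by rewrite -ler_pdivlMr// ge_min lexx orbT.
  apply: (le_trans (le_e _ e0)).
  have : e * e * C <= e * C by rewrite ler_wpM2r// ler_piMr// ltW.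
  nra.
- move=> k f k0 fp.
  apply: (cvg_le_near (JP _ (CpZ k0 fp)) (cvgM (cvg_cst k) (JP _ fp))).
  apply: filterS Gn => U oU; have [pp p0 _] := phiP _ oU.
  rewrite mulrA ler_wpM2r ?invr_ge0 ?cov_ge0//.
  exact: (cov_scale tgQ pp p0).
- move=> f g fp gp fg.
  apply: (cvg_le_near (JP _ fp) (JP _ gp)).
  apply: filterS Gn => U oU; have [pp p0 _] := phiP _ oU.
  by rewrite ler_wpM2r ?invr_ge0 ?cov_ge0//; exact: (cov_mono tgQ pp p0).
- move=> a f fp.
  have h : \forall U \near G, rho (fun x => f (a ** x)) U = rho f U.
    apply: filterS Gn => U oU; have [pp p0 _] := phiP _ oU.
    by rewrite /rho (cov_translate tgQ pp p0).
  apply/eqP; rewrite eq_le; apply/andP; split.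
    by apply: (cvg_le_near (JP _ (CpL tgQ a fp)) (JP _ fp)); apply: filterS h => U ->.
  by apply: (cvg_le_near (JP _ fp) (JP _ (CpL tgQ a fp))); apply: filterS h => U ->.
- exists f0 => //.
  have h : \forall U \near G, rho f0 U = 1.
    by apply: filterS Gn => U oU; rewrite /rho divff// gt_eqF// cov0.
  apply/eqP; rewrite eq_le; apply/andP; split.
    apply: (cvgr_to_le (JP _ f0p)); apply: filterS h => U ->; exact: lexx.
  by apply: (cvgr_to_ge (JP _ f0p)); apply: filterS h => U ->.
Qed.

(** The functional is extended by positive and negative parts. By additivity [J u - J v] is the same
    for all non-negative [u], [v] with difference [f], so each property is read off from a
    convenient decomposition. *)
Lemma left_haar_ex : exists J, left_haar J.
Proof.
have [J [JD JZ Jle JL [f0 f0p Jf0]]] := left_haar_pos_ex.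
pose pos f := fun x => Num.max (f x) 0.
pose neg f := fun x => Num.max (- f x) 0.
have posE f x : f x = pos f x - neg f x.
  by rewrite /pos /neg; case: (leP (f x) 0) => ?; case: (leP (- f x) 0) => ?; lra.
have pos0 f x : 0 <= pos f x by rewrite le_max lexx orbT.
have neg0 f x : 0 <= neg f x by rewrite le_max lexx orbT.
have posp f : Cc f -> Cp (pos f) by move=> cf; split=> //; exact: Cc_max0.
have negp f : Cc f -> Cp (neg f).
  move=> cf; split=> //; apply: (@Cc_max0 _ _ (fun x => - f x)).
  rewrite (_ : (fun x => - f x) = (fun x => -1 * f x)); first exact: CcZ.
  by apply/funext => x; rewrite mulN1r.
pose I f := J (pos f) - J (neg f).
have IE f u v : Cc f -> Cp u -> Cp v -> (forall x, f x = u x - v x) ->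
    I f = J u - J v.
  move=> cf up vp fuv.
  have : J (fun x => pos f x + v x) = J (fun x => u x + neg f x).
    by congr J; apply/funext => x; have := fuv x; rewrite posE; lra.
  by rewrite !JD//; [rewrite /I; lra|exact: negp|exact: posp].
have JZE k f : 0 <= k -> Cp f -> J (fun x => k * f x) = k * J f.
  move=> k0 fp; have [->|kN0] := eqVneq k 0.
    have -> : (fun x => 0 * f x) = (fun=> 0) by apply/funext => x; rewrite mul0r.
    have z : @Cp R Q (fun=> 0) by split; [exact: Cc0|].
    have := JD _ _ z z; rewrite (_ : (fun=> 0 + 0) = (fun=> 0)); first by lra.
    by apply/funext => x; rewrite addr0.
  have kgt : 0 < k by rewrite lt_neqAle eq_sym kN0.
  apply/eqP; rewrite eq_le JZ//= -ler_pdivlMl//.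
  have ki : 0 <= k^-1 by rewrite invr_ge0.
  have := JZ _ _ ki (CpZ k0 fp).
  by under eq_fun do rewrite mulrA mulVf// mul1r.
exists I; split.
- move=> f g cf cg.
  rewrite (IE _ (fun x => pos f x + pos g x) (fun x => neg f x + neg g x)).
  + by rewrite !JD; [rewrite /I; lra|exact: negp..|exact: posp|exact: posp].
  + exact: CcD.
  + by apply: CpD; exact: posp.
  + by apply: CpD; exact: negp.
  + by move=> x; rewrite [f x]posE [g x]posE; lra.
- move=> k f cf; have [k0|k0] := leP 0 k.
    rewrite (IE _ (fun x => k * pos f x) (fun x => k * neg f x)).
    + by rewrite !JZE//; [rewrite /I; lra|exact: negp|exact: posp].
    + exact: CcZ.
    + by apply: CpZ => //; exact: posp.
    + by apply: CpZ => //; exact: negp.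
    + by move=> x; rewrite [f x]posE; lra.
  have k0' : 0 <= - k by lra.
  rewrite (IE _ (fun x => - k * neg f x) (fun x => - k * pos f x)).
  + by rewrite !JZE//; [rewrite /I; lra|exact: posp|exact: negp].
  + exact: CcZ.
  + by apply: CpZ => //; exact: negp.
  + by apply: CpZ => //; exact: posp.
  + by move=> x; rewrite [f x]posE; lra.
- move=> f g cf cg fg.
  have : J (fun x => pos f x + neg g x) <= J (fun x => pos g x + neg f x).
    apply: Jle; [apply: CpD; [exact: posp|exact: negp]..|] => x.
    by have := fg x; rewrite [f x]posE [g x]posE; lra.
  rewrite !JD; [rewrite /I; lra|exact: posp|exact: negp|exact: posp|exact: negp].
- move=> a f cf.
  rewrite (IE _ (fun x => pos f (a ** x)) (fun x => neg f (a ** x))).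
  + by rewrite !JL//; [exact: negp|exact: posp].
  + exact: (CcL tgQ).
  + by apply: (CpL tgQ); exact: posp.
  + by apply: (CpL tgQ); exact: negp.
  + by move=> x; rewrite -posE.
- exists f0; first by case: f0p.
  rewrite (IE _ f0 (fun x => 0 * f0 x)) ?JZE ?Jf0//; first by lra.
  + by case: f0p.
  + exact: CpZ.
  + by move=> x; rewrite mul0r subr0.
Qed.

End HaarFunctional.

(** * Fubini's theorem and right invariance *)

Section Fubini.
Variables (R : realType) (Q : topologicalType).
Variables (mul : Q -> Q -> Q) (inv : Q -> Q) (one : Q).
Hypothesis tgQ : is_topological_group mul inv one.
Hypothesis hQ : hausdorff_space Q.
Hypothesis lcQ : locally_compact [set: Q].
Local Notation "x ** y" := (mul x y) (at level 40, left associativity).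
Implicit Types (f g phi : Q -> R) (l : seq (R * Q)).
Variable J : (Q -> R) -> R.
Hypothesis hJ : left_haar mul J.

Let JD f g : Cc f -> Cc g -> J (fun x => f x + g x) = J f + J g.
Proof. by case: hJ => h _ _ _ _; exact: h. Qed.
Let JZ k f : Cc f -> J (fun x => k * f x) = k * J f.
Proof. by case: hJ => _ h _ _ _; exact: h. Qed.
Let Jle f g : Cc f -> Cc g -> (forall x, f x <= g x) -> J f <= J g.
Proof. by case: hJ => _ _ h _ _; exact: h. Qed.
Let JL a f : Cc f -> J (fun x => f (a ** x)) = J f.
Proof. by case: hJ => _ _ _ h _; exact: h. Qed.

Lemma haar0 : J (fun=> 0) = 0.
Proof.
rewrite -[RHS](mul0r (J (fun=> 0))) -JZ; last exact: Cc0.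
by congr J; apply/funext => x; rewrite mul0r.
Qed.

Lemma haarB f g : Cc f -> Cc g -> J (fun x => f x - g x) = J f - J g.
Proof.
move=> cf cg; rewrite -mulN1r -JZ// -JD//; last exact: CcZ.
by congr J; apply/funext => x; rewrite mulN1r.
Qed.

Lemma haar_sum (I : Type) (r : seq I) (F : I -> Q -> R) :
  (forall i, Cc (F i)) -> J (fun x => \sum_(i <- r) F i x) = \sum_(i <- r) J (F i).
Proof.
move=> cF; elim: r => [|i r IH].
  rewrite big_nil -[RHS]haar0; congr J.
  by apply/funext => x; rewrite big_nil.
rewrite big_cons -IH -JD//; last exact: Cc_sum.
by congr J; apply/funext => x; rewrite big_cons.
Qed.

Lemma haar_dist f g h : Cc f -> Cc g -> Cc h -> (forall x, `|f x - g x| <= h x) ->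
  `|J f - J g| <= J h.
Proof.
move=> cf cg ch fgh; rewrite -haarB// ler_norml; apply/andP; split.
  rewrite -mulN1r -JZ//; apply: Jle => [||x]; [exact: CcZ|exact: CcB|].
  by have := fgh x; rewrite ler_norml mulN1r => /andP[].
apply: Jle => [||x]; [exact: CcB|by []|].
by have := fgh x; rewrite ler_norml => /andP[].
Qed.

Lemma haar_ge0 f : Cp f -> 0 <= J f.
Proof. by move=> [cf f0]; rewrite -haar0; apply: Jle => //; exact: Cc0. Qed.

(** Some [f] has [J f = 1], and it is dominated by finitely many translates of [c], each with the
    same integral as [c]. *)
Lemma haar_gt0 c a : Cp c -> 0 < c a -> 0 < J c.
Proof.
move=> cp ca; have [_ _ _ _ [f cf Jf]] := hJ.
have afp : Cp (fun x => `|f x|) by split=> //; exact: Cc_abs.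
have [l [l0 lf]] := dominates_ex tgQ afp cp ca.
have cc b : Cc (fun x => c (b ** x)) by apply: (CcL tgQ); case: cp.
have : 1 <= mass l * J c.
  rewrite -Jf /mass mulr_suml.
  under eq_bigr => p _ do rewrite -(JL (inv p.2) cp.1) -JZ//.
  rewrite -haar_sum => [|p]; last exact: CcZ.
  apply: Jle => // [|x]; first by apply: Cc_sum => p; exact: CcZ.
  exact: le_trans (ler_norm _) (lf x).
have := haar_ge0 cp; rewrite le_eqVlt => /orP[/eqP<-|//].
by rewrite mulr0 ler10.
Qed.

Lemma Cc_cutoff (A : set Q) : compact A -> exists2 c : Q -> R, Cp c &
  (forall x, c x <= 1) /\ forall x, A x -> c x = 1.
Proof.
move=> cA; have [g [[cg [K cK Kg]] g0] g1] := Cp_ge1 R hQ lcQ cA.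
exists (fun x => Num.min (g x) 1); split.
- split; first by move=> x; apply: continuous_min; [exact: cg|exact: cvg_cst].
  by exists K => // x /Kg ->; rewrite min_l.
- by move=> x; rewrite le_min g0/=.
- by move=> x; rewrite ge_min lexx orbT.
- by move=> x /g1 gx; rewrite min_r.
Qed.

(** The bumps are divided by the maximum of their sum and 1/2: this never vanishes, and on [A] it is
    the sum itself. *)
Lemma partition_of_unity (A : set Q) (V : Q -> set Q) : compact A ->
  (forall x, nbhs x (V x)) ->
  exists (r : seq Q) (p : Q -> Q -> R), [/\ forall z, Cp (p z),
    forall z x, p z x != 0 -> V z x,
    forall x, \sum_(z <- r) p z x <= 1 &
    forall x, A x -> \sum_(z <- r) p z x = 1].
Proof.
move=> cA nV.
have /choice[b bP] : forall z : Q, exists f : Q -> R,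
    [/\ Cp f, f z = 1 & forall x, f x != 0 -> V z x].
  move=> z; have [f [cf f01 fz fV]] := Cc_bump R hQ lcQ (nV z).
  by exists f; split=> //; split=> // x; case/andP: (f01 x).
have bC z : Cc (b z) by case: (bP z) => -[].
have b0 z x : 0 <= b z x by case: (bP z) => -[].
have [z Az|r _ rA] := @compact_seq_cover _ A (fun z => [set x | 1 / 2 < b z x]) cA.
  have /cvgr_gt := (bC z).1 z; apply.
  by case: (bP z) => _ -> _; lra.
pose P x := \sum_(z <- r) b z x.
have cP : continuous P by case: (Cc_sum r bC).
have P0 x : 0 <= P x by apply: sumr_ge0.
pose M x := Num.max (P x) (1 / 2).
have M0 x : 0 < M x by rewrite lt_max; apply/orP; right; lra.
have cM : continuous M.
  by move=> x; apply: continuous_max; [exact: cP|exact: cvg_cst].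
exists r, (fun z x => (M x)^-1 * b z x); split.
- move=> z; split=> [|x]; last by rewrite mulr_ge0// invr_ge0 ltW.
  by apply: CcMl => // x; apply: cvgV; [rewrite gt_eqF|exact: cM].
- move=> z x; have [_ _ bV] := bP z => h; apply: bV.
  by apply: contraNneq h => ->; rewrite mulr0.
- by move=> x; rewrite -mulr_sumr -/(P x) ler_pdivrMl// mulr1 le_max lexx.
- move=> x /rA[z zr /= bz]; rewrite -mulr_sumr -/(P x) /M max_l ?mulVf//.
    rewrite gt_eqF//; apply: (lt_le_trans (_ : 0 < b z x)); first by lra.
    by rewrite /P (perm_big _ (perm_to_rem zr)) big_cons/= lerDl sumr_ge0.
  apply: (le_trans (ltW bz)).
  by rewrite /P (perm_big _ (perm_to_rem zr)) big_cons/= lerDl sumr_ge0.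
Qed.

Section Kernel.
Variables (K : Q -> Q -> R) (A B : set Q).
Hypotheses (cA : compact A) (cB : compact B).
Hypothesis cK : continuous (fun p : Q * Q => K p.1 p.2).
Hypothesis KA : forall x y, ~ A x -> K x y = 0.
Hypothesis KB : forall x y, ~ B y -> K x y = 0.

Lemma kernel_Cc x : Cc (K x).
Proof.
split; last by exists B => // y /KB.
move=> y; have xy : (x, z) @[z --> y] --> (x, y).
  by apply: cvg_pair; [exact: cvg_cst|exact: cvg_id].
exact: (cvg_comp _ _ xy (@cK (x, y))).
Qed.

Lemma kernel_near x0 (e : R) : 0 < e ->
  \forall x \near x0, forall y, `|K x y - K x0 y| <= e.
Proof.
move=> e0; apply: (near_uniform e0 cB) => [x y /KB//|y].
exact: (@cK (x0, y)).
Qed.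

Lemma kernel_haar_Cc : Cc (fun x => J (K x)).
Proof.
split; last first.
  exists A => // x nAx; rewrite -[RHS]haar0; congr J.
  by apply/funext => y; exact: KA.
move=> x0; apply/cvgrPdist_le => e e0.
have [b bp b1] := Cp_ge1 R hQ lcQ cB.
have Jb := haar_ge0 bp.
(* Since [b] is at least 1 on [B], a uniform bound on [K x - K x0] may be multiplied by [b] and then
   integrates to that bound times [J b]. *)
have d0 : 0 < e / (J b + 1) by rewrite divr_gt0// ltr_wpDl.
apply: filterS (kernel_near x0 d0) => x Kx; rewrite distrC.
have : `|J (K x) - J (K x0)| <= e / (J b + 1) * J b.
  rewrite -JZ; last by case: bp.
  apply: haar_dist; [exact: kernel_Cc|exact: kernel_Cc|by apply: CcZ; case: bp|].
  move=> y; have [By|nBy] := pselect (B y).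
    by rewrite (le_trans (Kx y))// ler_peMr ?b1// ltW.
  by rewrite !KB// subrr normr0 mulr_ge0 ?(ltW d0)//; case: bp.
move=> /le_trans; apply.
by rewrite mulrAC ler_pdivrMr ?ltr_wpDl// ler_wpM2l ?lerDl// ltW.
Qed.

End Kernel.

(** A partition of unity in [x] approximates [K x y] by a finite sum of products [w z x * K z y],
    for which the order of integration is irrelevant. The pointwise error [e * a x * b y] puts both
    iterated integrals within [e * (J a * J b)] of the same number. *)
Lemma haar_fubini (K : Q -> Q -> R) (A B : set Q) : compact A -> compact B ->
  continuous (fun p : Q * Q => K p.1 p.2) ->
  (forall x y, ~ A x -> K x y = 0) -> (forall x y, ~ B y -> K x y = 0) ->
  J (fun x => J (K x)) = J (fun y => J (K^~ y)).
Proof.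
move=> cA cB cK KA KB.
have cK' : continuous (fun p : Q * Q => K p.2 p.1).
  move=> [x y]; have xy : (p.2, p.1) @[p --> (x, y)] --> (y, x).
    by apply: cvg_pair; [exact: cvg_snd|exact: cvg_fst].
  exact: (cvg_comp _ _ xy (cK (y, x))).
have Cx := kernel_Cc cB cK KB.
have Cy y : Cc (K^~ y) by apply: (@kernel_Cc (fun y x => K x y) A) => // *; exact: KA.
have CJx := kernel_haar_Cc cA cB cK KA KB.
have CJy : Cc (fun y => J (K^~ y)).
  by apply: (@kernel_haar_Cc (fun y x => K x y) B A) => // *; [exact: KB|exact: KA].
have [a ap [_ a1]] := Cc_cutoff cA.
have [b bp [_ b1]] := Cc_cutoff cB.
have a0 x : 0 <= a x by case: ap.
have b0 x : 0 <= b x by case: bp.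
apply/eqP; rewrite -subr_eq0 -normr_le0; apply/ler_addgt0Pr => d d0; rewrite add0r.
pose e := d / (2 * (J a * J b) + 1).
have Jab : 0 <= J a * J b by rewrite mulr_ge0// haar_ge0.
have e0 : 0 < e by rewrite divr_gt0//; lra.
have ed : 2 * (e * (J a * J b)) <= d.
  have : e * (2 * (J a * J b) + 1) = d by rewrite /e divfK// gt_eqF//; lra.
  lra.
have [r [p [pp pV p_le p_eq]]] := partition_of_unity cA (fun z => kernel_near cB cK KB z e0).
have p0 z x : 0 <= p z x by case: (pp z).
pose w z x := a x * p z x.
have wC z : Cc (w z) by apply: CcMl; [case: ap => -[]|case: (pp z)].
have Kw x y : `|K x y - \sum_(z <- r) w z x * K z y| <= e * a x * b y.
  have -> : K x y = \sum_(z <- r) w z x * K x y.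
    rewrite -mulr_suml -mulr_sumr; have [Ax|nAx] := pselect (A x).
      by rewrite a1// p_eq// !mul1r.
    by rewrite KA// mulr0.
  rewrite -sumrB; apply: (le_trans (ler_norm_sum _ _ _)).
  apply: (@le_trans _ _ (\sum_(z <- r) w z x * (e * b y))).
    apply: ler_sum => z _; rewrite /w -mulrBr normrM ger0_norm ?mulr_ge0//.
    have [->|/pV Vzx] := eqVneq (p z x) 0; first by rewrite mulr0 !mul0r.
    apply: ler_wpM2l; first by rewrite mulr_ge0.
    have [By|nBy] := pselect (B y); first by rewrite b1// mulr1; exact: Vzx.
    by rewrite !KB// subrr normr0 mulr_ge0// ltW.
  rewrite -mulr_suml -mulr_sumr [leRHS](_ : _ = a x * 1 * (e * b y)); last by ring.
  by apply: ler_wpM2r; [rewrite mulr_ge0// ltW|exact: ler_wpM2l].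
have b_Cc : Cc b by case: bp.
have a_Cc : Cc a by case: ap.
have S1 : `|J (fun x => J (K x)) - \sum_(z <- r) J (K z) * J (w z)| <= e * (J a * J b).
  have -> : \sum_(z <- r) J (K z) * J (w z) = J (fun x => \sum_(z <- r) J (K z) * w z x).
    rewrite haar_sum => [|z]; last exact: CcZ.
    by apply: eq_bigr => z _; rewrite JZ.
  rewrite mulrA mulrAC -JZ//; apply: haar_dist => //.
  - by apply: Cc_sum => z; exact: CcZ.
  - exact: CcZ.
  move=> x; have -> : \sum_(z <- r) J (K z) * w z x = J (fun y => \sum_(z <- r) w z x * K z y).
    rewrite haar_sum => [|z]; last exact: CcZ.
    by apply: eq_bigr => z _; rewrite JZ// mulrC.
  rewrite mulrAC -JZ//; apply: haar_dist => //; last exact: CcZ.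
  by apply: Cc_sum => z; exact: CcZ.
have S2 : `|J (fun y => J (K^~ y)) - \sum_(z <- r) J (K z) * J (w z)| <= e * (J a * J b).
  have -> : \sum_(z <- r) J (K z) * J (w z) = J (fun y => \sum_(z <- r) J (w z) * K z y).
    rewrite haar_sum => [|z]; last exact: CcZ.
    by apply: eq_bigr => z _; rewrite JZ// mulrC.
  rewrite mulrA -JZ//; apply: haar_dist => //.
  - by apply: Cc_sum => z; exact: CcZ.
  - exact: CcZ.
  move=> y; have -> : \sum_(z <- r) J (w z) * K z y = J (fun x => \sum_(z <- r) K z y * w z x).
    rewrite haar_sum => [|z]; last exact: CcZ.
    by apply: eq_bigr => z _; rewrite JZ// mulrC.
  rewrite mulrAC -JZ//; apply: haar_dist => //; [|exact: CcZ|].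
    by apply: Cc_sum => z; exact: CcZ.
  move=> x; under eq_bigr do rewrite mulrC.
  by rewrite mulrAC; exact: Kw.
apply: le_trans ed; rewrite (_ : 2 * _ = e * (J a * J b) + e * (J a * J b)); last by ring.
apply: le_trans (lerD S1 S2); rewrite -(distrC (\sum_(z <- r) _)) in S2 *.
exact: ler_distD.
Qed.
End Fubini.

Lemma fsum_seq (R : realType) (I : choiceType) (D : set I) (F : I -> R) (r : seq I) :
  uniq r -> (forall i, i \in r -> D i) -> (forall i, D i -> F i != 0 -> i \in r) ->
  \sum_(i \in D) F i = \sum_(i <- r) F i.
Proof.
move=> ur rD Dr; rewrite (fsbigE r)//.
  by rewrite big_mkcond/= !big_seq; apply: eq_bigr => i /rD Di; rewrite mem_set.
by move=> i Di; apply: contraNeq; exact: Dr.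
Qed.

Section Lattice.
Variables (R : realType) (Q : topologicalType).
Variables (mul : Q -> Q -> Q) (inv : Q -> Q) (one : Q).
Hypothesis tgQ : is_topological_group mul inv one.
Hypothesis hQ : hausdorff_space Q.
Hypothesis lcQ : locally_compact [set: Q].
Local Notation "x ** y" := (mul x y) (at level 40, left associativity).
Let gQ := tg_group tgQ.
Variable Lam : set Q.
Hypothesis LamG : is_subgroup mul inv one Lam.

Let Lam1 : Lam one. Proof. by case: LamG. Qed.
Let LamM x y : Lam x -> Lam y -> Lam (x ** y). Proof. by case: LamG => _ h _; exact: h. Qed.
Let LamV x : Lam x -> Lam (inv x). Proof. by case: LamG => _ _ h; exact: h. Qed.

(** Proper discontinuity, with the finite set of group elements given as a list so that sums over
    [Lam] become sums over sequences. *)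
Definition locally_finite_action := forall C, compact C -> exists r : seq Q,
  [/\ uniq r, forall l, l \in r -> Lam l &
      forall l x, Lam l -> C x -> C (l ** x) -> l \in r].

(** An element moving a point of [C] into [C] lies in the compact set [C C^-1]. This is covered by
    finitely many sets [V z], each so small that it contains at most one element of [Lam]. *)
Lemma discrete_locally_finite : discrete_subset Lam -> locally_finite_action.
Proof.
move=> dLam C cC; have [U [oU U1 ULam]] := dLam _ Lam1.
have /choice[V VP] : forall z : Q, exists V : set Q,
    nbhs z V /\ forall x y, V x -> V y -> U (inv x ** y).
  move=> z.
  have h : inv p.1 ** p.2 @[p --> (z, z)] --> inv z ** z.
    by apply: (cvg_gmul tgQ); [apply: (cvg_ginv tgQ); exact: cvg_fst|exact: cvg_snd].
  rewrite (gmulV gQ) in h.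
  have [[A B]/= [zA zB] AB] := h _ (open_nbhs_nbhs (conj oU U1)).
  exists (A `&` B); split; first exact: filterI.
  by move=> x y [Ax _] [_ By]; exact: (AB (x, y)).
(* [g z] is the element of [Lam] in [V z], or the default [one] when there is none. *)
have /choice[g gP] : forall z : Q, exists l, Lam l /\ forall m, Lam m -> V z m -> m = l.
  move=> z; have [[l [Ll Vl]]|nl] := pselect (exists l, Lam l /\ V z l); last first.
    by exists one; split=> // m Lm Vm; exfalso; apply: nl; exists m.
  exists l; split=> // m Lm Vm.
  have : (U `&` Lam) (inv l ** m).
    by split; [exact: (VP z).2|exact/LamM/Lm/LamV].
  rewrite ULam => e; apply: (gmulI gQ (x := inv l)).
  by rewrite e (gmulV gQ).
have cE := compact_gmul tgQ cC (compact_ginv tgQ cC).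
have [r0 _ r0P] := compact_seq_cover cE (fun z _ => (VP z).1).
exists (undup [seq g z | z <- r0]); split.
- exact: undup_uniq.
- by move=> l; rewrite mem_undup => /mapP[z _ ->]; case: (gP z).
- move=> l x Ll Cx Clx.
  have /r0P[z zr Vzl] : [set x ** y | x in C & y in inv @` C] l.
    exists (l ** x) => //; exists (inv x); first by exists x.
    by rewrite (gmulK gQ).
  by rewrite mem_undup; apply/mapP; exists z => //; exact: (gP z).2.
Qed.

Hypothesis Lfin : locally_finite_action.

Variable c : Q -> R.
Hypothesis cp : Cp c.
Hypothesis c_sum : forall y, \sum_(l \in Lam) c (l ** y) = 1.

(** Only elements moving a point of [E] into the support of [c] contribute, and these are finitely
    many. Closing their list under inverses gives the second sum along with the first. *)
Lemma lattice_seq (E : set Q) : compact E -> exists r : seq Q,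
  [/\ uniq r, forall l, l \in r -> Lam l,
      forall y, E y -> \sum_(l <- r) c (l ** y) = 1 &
      forall y, E y -> \sum_(l <- r) c (inv l ** y) = 1].
Proof.
move=> cE; have [[_ [S cS Sc]] _] := cp.
have [r0 [u0 r0L r0P]] := Lfin (@compactU _ E S cE cS).
have cN0 l y : c (l ** y) != 0 -> (E `|` S) (l ** y).
  by move=> h; right; apply: contrapT => /Sc ch; rewrite ch eqxx in h.
pose r := undup (r0 ++ map inv r0).
have rL l : l \in r -> Lam l.
  by rewrite mem_undup mem_cat => /orP[/r0L//|/mapP[m /r0L/LamV Lm ->]].
have rV l : l \in r -> inv l \in r.
  rewrite !mem_undup !mem_cat => /orP[lr|/mapP[m mr ->]].
    by apply/orP; right; exact: map_f.
  by rewrite (ginvK gQ) mr.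
have ur : uniq r by exact: undup_uniq.
have rE y : E y -> forall l, Lam l -> c (l ** y) != 0 -> l \in r.
  move=> Ey l Ll ch; rewrite mem_undup mem_cat (r0P l y)//; first by left.
  exact: cN0.
exists r; split=> // y Ey; first by rewrite -(fsum_seq ur rL (rE _ Ey)).
rewrite -(big_map inv xpredT (fun l => c (l ** y))) -(c_sum y).
apply/esym/fsum_seq.
- by rewrite map_inj_uniq// => a b e; rewrite -[a](ginvK gQ) e (ginvK gQ).
- by move=> _ /mapP[l lr ->]; apply/LamV/rL.
- move=> l Ll ch; rewrite -[l](ginvK gQ); apply: map_f; apply: rV.
  exact: rE Ey _ _ ch.
Qed.

Variable J : (Q -> R) -> R.
Hypothesis hJ : left_haar mul J.

Let JZ k f : Cc f -> J (fun x => k * f x) = k * J f.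
Proof. by case: hJ => _ h _ _ _; exact: h. Qed.
Let JL a f : Cc f -> J (fun x => f (a ** x)) = J f.
Proof. by case: hJ => _ _ _ h _; exact: h. Qed.

Lemma weight_pos : exists a, 0 < c a.
Proof.
apply: contrapT => nc.
have c0 x : c x = 0.
  apply/eqP; rewrite eq_le; apply/andP; split; last by case: cp.
  by rewrite leNgt; apply/negP => h; apply: nc; exists x.
have := c_sum one; rewrite fsbig1 => [|l _]; last exact: c0.
by move/eqP; rewrite eq_sym oner_eq0.
Qed.

(* Both sides, multiplied by [J c], are double integrals of
   [c x * c y * phi (x^-1 * l^-1 * y)] summed over [l] in [Lam], the orders of
   integration being opposite. *)
Lemma haar_inv (phi : Q -> R) : Cc phi -> J (fun x => phi (inv x)) = J phi.
Proof.
move=> cphi; have [_ [S cS Sphi]] := cphi.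
have [[cc [C cC Cc0]] c0] := cp.
have c_Cc : Cc c by case: cp.
pose E := [set x ** y | x in C & y in S] `|`
  ([set x ** y | x in C & y in inv @` S] `|` C).
have cCS := compact_gmul tgQ cC cS.
have cCS' := compact_gmul tgQ cC (compact_ginv tgQ cS).
have cE : compact E by apply: compactU => //; exact: compactU.
have [r [_ rL r1 r2]] := lattice_seq cE.
have CN0 x : c x != 0 -> C x.
  by move=> h; apply: contrapT => /Cc0 ch; rewrite ch eqxx in h.
have SN0 x : phi x != 0 -> S x.
  by move=> h; apply: contrapT => /Sphi ch; rewrite ch eqxx in h.
have [a ca] := weight_pos.
have Jc0 : J c != 0 by rewrite gt_eqF// (haar_gt0 tgQ hJ cp ca).
pose K l x y := c x * c y * phi (inv x ** inv l ** y).
have KC l x y : ~ C x -> K l x y = 0 by move=> nC; rewrite /K Cc0// !mul0r.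
have KC' l x y : ~ C y -> K l x y = 0 by move=> nC; rewrite /K (Cc0 y)// mulr0 mul0r.
have cK l : continuous (fun p : Q * Q => K l p.1 p.2).
  move=> [x y].
  have h1 : c p.1 * c p.2 @[p --> (x, y)] --> c x * c y.
    apply: cvgM.
      by apply: (cvg_comp fst c _ (cc x)); exact: cvg_fst.
    by apply: (cvg_comp snd c _ (cc y)); exact: cvg_snd.
  have h2 : inv p.1 ** inv l ** p.2 @[p --> (x, y)] --> inv x ** inv l ** y.
    apply: (cvg_gmul tgQ); last exact: cvg_snd.
    by apply: (cvg_gmul tgQ); [apply: (cvg_ginv tgQ); exact: cvg_fst|exact: cvg_cst].
  exact: cvgM h1 (cvg_comp _ _ h2 (cphi.1 _)).
have KCc l x : Cc (K l x) by exact: (kernel_Cc cC (@cK l) (@KC' l)).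
have KCc' l y : Cc ((K l)^~ y).
  apply: (@kernel_Cc _ _ (fun y x => K l x y) C cC); last by move=> *; exact: KC.
  move=> [x z]; have xy : (p.2, p.1) @[p --> (x, z)] --> (z, x).
    by apply: cvg_pair; [exact: cvg_snd|exact: cvg_fst].
  exact: (cvg_comp _ _ xy (@cK l (z, x))).
have JKC l : Cc (fun x => J (K l x)).
  exact: (kernel_haar_Cc hQ lcQ hJ cC cC (@cK l) (@KC l) (@KC' l)).
have JKC' l : Cc (fun y => J ((K l)^~ y)).
  apply: (@kernel_haar_Cc _ _ mul hQ lcQ J hJ (fun y x => K l x y) C C) => //.
  + move=> [x z]; have xy : (p.2, p.1) @[p --> (x, z)] --> (z, x).
      by apply: cvg_pair; [exact: cvg_snd|exact: cvg_fst].
    exact: (cvg_comp _ _ xy (@cK l (z, x))).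
  + by move=> *; exact: KC'.
  + by move=> *; exact: KC.
(* Left translation of [y] by [l] turns the factor [c y] into [c (l ** y)] and removes [l] from the
   argument of [phi]; the sum over [l] is then 1. *)
have s1 : J c * J phi = \sum_(l <- r) J (fun x => J (K l x)).
  rewrite -(haar_sum hJ)// mulrC -JZ//; congr J; apply/funext => x.
  rewrite mulrC -(JL (inv x) cphi) -JZ; last exact: (CcL tgQ).
  have -> : \sum_(l <- r) J (K l x) = \sum_(l <- r) J (fun y => K l x (l ** y)).
    by apply: eq_bigr => l _; rewrite JL.
  rewrite -(haar_sum hJ) => [|l]; last exact: (CcL tgQ).
  congr J; apply/funext => y; rewrite /K.
  under eq_bigr do rewrite (gmulA gQ) (gmulKV gQ) mulrAC.
  rewrite -mulr_sumr.
  have [->|hN0] := eqVneq (c x * phi (inv x ** y)) 0; first by rewrite mul0r.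
  rewrite r1 ?mulr1//; left; exists x.
    by apply: CN0; apply: contraNneq hN0 => ->; rewrite mul0r.
  exists (inv x ** y); last by rewrite (gKVmul gQ).
  by apply: SN0; apply: contraNneq hN0 => ->; rewrite mulr0.
(* Here [x] is translated instead, by [inv l], and the sum of [c (inv l ** x)] is 1. *)
have s2 : J c * J (fun x => phi (inv x)) = \sum_(l <- r) J (fun y => J ((K l)^~ y)).
  have cphi' := CcV tgQ cphi.
  rewrite -(haar_sum hJ)// mulrC -JZ//; congr J; apply/funext => y.
  rewrite mulrC -(JL (inv y) cphi') -JZ; last exact: (CcL tgQ (inv y) cphi').
  have -> : \sum_(l <- r) J ((K l)^~ y) = \sum_(l <- r) J (fun x => K l (inv l ** x) y).
    by apply: eq_bigr => l _; rewrite -(JL (inv l) (KCc' l y)).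
  rewrite -(haar_sum hJ) => [|l]; last exact: (CcL tgQ (inv l) (KCc' l y)).
  congr J; apply/funext => x; rewrite /K.
  have e l : c (inv l ** x) * c y * phi (inv (inv l ** x) ** inv l ** y) =
      c y * phi (inv (inv y ** x)) * c (inv l ** x).
    rewrite !(ginvM gQ) !(ginvK gQ) -(gmulA gQ (inv x)) (gmulrV gQ) (gmulr1 gQ); ring.
  under eq_bigr do rewrite e.
  rewrite -mulr_sumr.
  have [->|hN0] := eqVneq (c y * phi (inv (inv y ** x))) 0; first by rewrite mul0r.
  rewrite r2 ?mulr1//; right; left; exists y.
    by apply: CN0; apply: contraNneq hN0 => ->; rewrite mul0r.
  exists (inv y ** x); last by rewrite (gKVmul gQ).
  exists (inv (inv y ** x)); last by rewrite (ginvK gQ).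
  by apply: SN0; apply: contraNneq hN0 => ->; rewrite mulr0.
apply: (mulfI Jc0); rewrite s1 s2; apply: eq_bigr => l _; apply/esym.
exact: (haar_fubini hQ lcQ hJ cC cC (@cK l) (@KC l) (@KC' l)).
Qed.

(** Inversion conjugates right translations into left ones, so [haar_inv] is used before and after a
    left translation. *)
Lemma haar_right (a : Q) (phi : Q -> R) : Cc phi -> J (fun x => phi (x ** a)) = J phi.
Proof.
move=> cphi; have cV := CcV tgQ cphi.
rewrite -(haar_inv cphi) -(JL (inv a) cV) -(haar_inv (CcL tgQ (inv a) cV)).
congr J; apply/funext => x.
by rewrite (ginvM gQ) !(ginvK gQ).
Qed.

End Lattice.

(** * Weights and averages for a discrete subgroup *)

Section Shift.
Variables (R : realType) (Q : topologicalType).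
Variables (mul : Q -> Q -> Q) (inv : Q -> Q) (one : Q).
Hypothesis tgQ : is_topological_group mul inv one.
Hypothesis hQ : hausdorff_space Q.
Hypothesis lcQ : locally_compact [set: Q].
Local Notation "x ** y" := (mul x y) (at level 40, left associativity).
Let gQ := tg_group tgQ.
Variable Lam : set Q.
Hypothesis LamG : is_subgroup mul inv one Lam.
Hypothesis Lfin : locally_finite_action mul Lam.

Let LamM x y : Lam x -> Lam y -> Lam (x ** y). Proof. by case: LamG => _ h _; exact: h. Qed.
Let LamV x : Lam x -> Lam (inv x). Proof. by case: LamG => _ _ h; exact: h. Qed.

(** Right invariance moves the shift from [u] to [c]. Inserting [\sum_l c (l ** x) = 1] and
    translating each summand by [inv l] leaves [c x] times the mean of [u (inv l ** x)] with weights
    [c (inv l ** x ** inv g)], which sum to 1; every value in this mean is within [D] of [u x]. *)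
Lemma haar_shift (c : Q -> R) (J : (Q -> R) -> R) (u : Q -> R) (g : Q) (D : R) :
  Cp c -> (forall y, \sum_(l \in Lam) c (l ** y) = 1) -> left_haar mul J ->
  continuous u -> (forall l y, Lam l -> `|u (l ** y) - u y| <= D) ->
  `|J (fun y => c y * u (y ** g)) - J (fun y => c y * u y)| <= D * J c.
Proof.
move=> cp c_sum hJ cu uD.
have [_ JZ _ JL _] := hJ.
have [[cc [C cC Cc0]] c0] := cp.
have c_Cc : Cc c by case: cp.
have cuL a b : continuous (fun y => u (a ** y ** b)).
  move=> y; apply: (cvg_comp (fun y => a ** y ** b) u _ (cu _)).
  apply: (cvg_gmul tgQ); last exact: cvg_cst.
  exact: (continuous_gmull tgQ).
have cut v a : continuous v -> Cc (fun x => c (a ** x) * v x).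
  move=> cv; rewrite (_ : (fun x => c (a ** x) * v x) = (fun x => v x * c (a ** x))).
    by apply: CcMl => //; exact: (CcL tgQ).
  by apply/funext => x; rewrite mulrC.
have cut1 v : continuous v -> Cc (fun x => c x * v x).
  move=> /(cut _ one); rewrite (_ : (fun x => c (one ** x) * v x) = (fun x => c x * v x))//.
  by apply/funext => x; rewrite (gmul1 gQ).
have cE : compact ([set x ** y | x in C & y in [set g]] `|`
    [set x ** y | x in C & y in [set inv g]]).
  by apply: compactU; apply: (compact_gmul tgQ cC); exact: compact_set1.
have [r [_ rL r1 r2]] := lattice_seq tgQ LamG Lfin cp c_sum cE.
have CN0 x : c x != 0 -> C x.
  by move=> h; apply: contrapT => /Cc0 ch; rewrite ch eqxx in h.
have cug : continuous (fun y => u (y ** g)).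
  move=> y; apply: (cvg_comp (mul^~ g) u _ (cu _)).
  exact: (continuous_gmulr tgQ).
rewrite -(haar_right tgQ hQ lcQ LamG Lfin cp c_sum hJ (inv g) (cut1 _ cug)).
pose F l x := c (l ** x) * (c (x ** inv g) * u x).
have cF l : Cc (F l).
  apply: cut => x; apply: cvgM; last exact: cu.
  apply: (cvg_comp (mul^~ (inv g)) c _ (cc _)).
  exact: (continuous_gmulr tgQ).
have -> : J (fun x => c (x ** inv g) * u (x ** inv g ** g)) =
    J (fun x => \sum_(l <- r) F (l) (inv l ** x)).
  transitivity (J (fun x => \sum_(l <- r) F l x)).
    congr J; apply/funext => x; rewrite -mulr_suml (gmulKV gQ).
    have [->|hN0] := eqVneq (c (x ** inv g)) 0; first by rewrite mul0r mulr0.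
    rewrite r1 ?mul1r//; left; exists (x ** inv g); first exact: CN0.
    by exists g => //; rewrite (gmulKV gQ).
  rewrite !(haar_sum hJ)// => [|l]; last exact: (CcL tgQ).
  by apply: eq_bigr => l _; rewrite JL.
rewrite -JZ//; apply: (haar_dist hJ).
- by apply: Cc_sum => l; exact: (CcL tgQ).
- exact: cut1.
- exact: CcZ.
move=> x; rewrite /F; under eq_bigr do rewrite (gKVmul gQ).
rewrite -mulr_sumr -mulrBr normrM ger0_norm// mulrC.
have [->|hN0] := eqVneq (c x) 0; first by rewrite !mulr0.
rewrite ler_wpM2r//.
have sum1 : \sum_(l <- r) c (inv l ** x ** inv g) = 1.
  under eq_bigr do rewrite -(gmulA gQ).
  apply: r2; right; exists x; first exact: CN0.
  by exists (inv g).
have -> : u x = \sum_(l <- r) c (inv l ** x ** inv g) * u x.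
  by rewrite -mulr_suml sum1 mul1r.
rewrite -sumrB; apply: (le_trans (ler_norm_sum _ _ _)).
rewrite -[leRHS]mul1r -sum1 mulr_suml !big_seq; apply: ler_sum => l lr.
rewrite -mulrBr normrM ger0_norm// ler_wpM2l//.
by apply: uD; exact/LamV/rL.
Qed.

(** The index [(l, a)] stands for the bump [psi (l ** y ** inv a)], which is [psi one] at
    [y = inv l ** a]. *)
Definition weight_index (A : seq Q) : set (Q * Q) :=
  [set i | Lam i.1 /\ i.2 \in A].

(** The sum [g] of finitely many right translates of [psi] is positive on [K]. As [K] meets every
    orbit, the sum [S] of [g] over [Lam] is positive everywhere; it is [Lam]-invariant by reindexing
    and continuous because locally one finite list suffices. Dividing by [S] gives the weights, and
    [c] is [g / S]. *)
Lemma weights_ex (psi : Q -> R) (K : set Q) : Cp psi -> 0 < psi one ->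
  compact K -> (forall y, exists2 l, Lam l & K (l ** y)) ->
  exists (A : seq Q) (S : Q -> R), let W i y := psi (i.1 ** y ** inv i.2) / S y in
  [/\ [/\ continuous S, forall y, 0 < S y & forall l y, Lam l -> S (l ** y) = S y],
      forall C, compact C -> exists r : seq (Q * Q),
        [/\ uniq r, forall i, i \in r -> weight_index A i &
            forall i y, weight_index A i -> C y -> W i y != 0 -> i \in r],
      forall y, \sum_(i \in weight_index A) W i y = 1 &
      exists c : Q -> R, Cp c /\ forall y, \sum_(l \in Lam) c (l ** y) = 1].
Proof.
move=> psip psi1 cK KL.
have [[cpsi [T cT Tpsi]] psi0] := psip.
have [y Ky|A0 _ A0P] := @compact_seq_cover _ K (fun a => [set y | 0 < psi (y ** inv a)]) cK.
  have : psi (z ** inv y) @[z --> y] --> psi (y ** inv y).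
    apply: (cvg_comp (mul^~ (inv y)) psi _ (cpsi _)).
    exact: (continuous_gmulr tgQ).
  by move=> /cvgr_gt; apply; rewrite (gmulrV gQ).
pose A := undup A0.
pose g y := \sum_(a <- A) psi (y ** inv a).
have gp : Cp g.
  split; last by move=> y; apply: sumr_ge0 => a _; exact: psi0.
  by apply: Cc_sum => a; apply: (CcR tgQ); case: psip.
have cTA : compact [set x ** y | x in T & y in [set` A]].
  by apply: (compact_gmul tgQ cT); exact/finite_compact/finite_seq.
have psiTA l y a : a \in A -> psi (l ** y ** inv a) != 0 ->
    [set x ** y | x in T & y in [set` A]] (l ** y).
  move=> aA h; exists (l ** y ** inv a).
    by apply: contrapT => /Tpsi e; rewrite e eqxx in h.
  by exists a => //; rewrite (gmulKV gQ).
have Lr C : compact C -> exists r : seq Q, [/\ uniq r, forall l, l \in r -> Lam l &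
    forall l y a, Lam l -> C y -> a \in A -> psi (l ** y ** inv a) != 0 -> l \in r].
  move=> cC; have [r [ur rL rP]] := Lfin (@compactU _ _ _ cC cTA).
  exists r; split=> // l y a Ll Cy aA h.
  by apply: (rP l y) => //; [left|right; exact: psiTA h].
have gN0 (r : seq Q) (C : set Q) : (forall l y a, Lam l -> C y -> a \in A -> psi (l ** y ** inv a) != 0 ->
    l \in r) -> forall l y, Lam l -> C y -> g (l ** y) != 0 -> l \in r.
  move=> rP l y Ll Cy; apply: contraNT => lr.
  rewrite /g big_seq big1// => a aA; apply/eqP.
  by apply: contraNT lr; exact: rP Ll Cy aA.
pose S y := \sum_(l \in Lam) g (l ** y).
have S_seq C : compact C -> exists2 r : seq Q, (forall l y, Lam l -> C y ->
     g (l ** y) != 0 -> l \in r) & forall y, C y -> S y = \sum_(l <- r) g (l ** y).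
  move=> cC; have [r [ur rL /gN0 rP]] := Lr _ cC.
  exists r => // y Cy; apply: fsum_seq => // l Ll h.
  exact: rP Ll Cy h.
have S_gt0 y : 0 < S y.
  have [l0 Ll0 Kl0] := KL y; have [a aA ga] := A0P _ Kl0.
  have gl0 : 0 < g (l0 ** y).
    have aA' : a \in A by rewrite mem_undup.
    rewrite /g (perm_big _ (perm_to_rem aA')) big_cons/= ltr_wpDr// sumr_ge0//.
  have [r rP ->] := S_seq _ (@compact_set1 _ y); last by [].
  have lr : l0 \in r by apply: (rP l0 y) => //; rewrite gt_eqF.
  rewrite (perm_big _ (perm_to_rem lr)) big_cons/= ltr_wpDr// sumr_ge0// => l _.
  by case: gp.
have cS : continuous S.
  move=> y; have [C [yC cC _]] := lc_nbhs lcQ y.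
  have [r _ rS] := S_seq _ cC.
  have cr : continuous (fun z => \sum_(l <- r) g (l ** z)).
    by case: (Cc_sum r (fun l => CcL tgQ l gp.1)).
  rewrite /continuous_at rS; last exact: nbhs_singleton.
  apply: cvg_trans (cr y); apply: near_eq_cvg.
  by apply: filterS yC => z Cz; rewrite rS.
have S_inv m y : Lam m -> S (m ** y) = S y.
  move=> Lm; rewrite /S (reindex_fsbig (fun l => l ** m) Lam Lam (fun l => g (l ** y))).
    by apply: eq_fsbigr => l _; rewrite (gmulA gQ).
  split=> [l Ll|l l' _ _ /(gmulIr gQ)//|l Ll]; first exact: LamM.
  by exists (l ** inv m); [exact/LamM/LamV|rewrite (gmulKV gQ)].
exists A, S => W; split.
- by split.
- move=> C cC; have [r [ur rL rP]] := Lr _ cC.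
  exists [seq (l, a) | l <- r, a <- A]; split.
  + by apply: allpairs_uniq => //; [exact: undup_uniq|move=> [? ?] [? ?]].
  + by move=> _ /allpairsP[[l a]/= [lr aA ->]]; split=> //; exact: rL.
  + move=> [l a] y [/= Ll aA] Cy; rewrite mulf_eq0 negb_or => /andP[h _].
    by apply/allpairsP; exists (l, a); split=> //; exact: rP Ll Cy aA h.
- move=> y; have [r [ur rL rP]] := Lr _ (@compact_set1 _ y).
  rewrite (@fsum_seq _ _ _ _ [seq (l, a) | l <- r, a <- A]).
  + rewrite big_allpairs_dep/= -[RHS](divff (lt0r_neq0 (S_gt0 y))).
    rewrite {1}/S (@fsum_seq _ _ _ _ r)//; last first.
      by move=> l Ll h; exact: (gN0 r [set y] rP l y Ll erefl h).
    rewrite mulr_suml; apply: eq_bigr => l _.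
    by rewrite /g mulr_suml.
  + by apply: allpairs_uniq => //; [exact: undup_uniq|move=> [? ?] [? ?]].
  + by move=> _ /allpairsP[[l a]/= [lr aA ->]]; split=> //; exact: rL.
  + move=> [l a] [/= Ll aA]; rewrite mulf_eq0 negb_or => /andP[h _].
    by apply/allpairsP; exists (l, a); split=> //; exact: rP Ll _ aA h.
- exists (fun y => (S y)^-1 * g y); split.
    split; last by move=> y; rewrite mulr_ge0// ?invr_ge0 ?(ltW (S_gt0 _))//; case: gp.
    apply: CcMl; last by case: gp.
    by move=> y; apply: cvgV; [rewrite gt_eqF|exact: cS].
  move=> y; have [r [ur rL rP]] := Lr _ (@compact_set1 _ y).
  have gr l : Lam l -> g (l ** y) != 0 -> l \in r.
    by move=> Ll h; exact: (gN0 r [set y] rP l y Ll erefl h).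
  rewrite (@fsum_seq _ _ _ _ r)//; last first.
    by move=> l Ll; rewrite mulf_eq0 negb_or => /andP[_]; exact: gr.
  rewrite (eq_big_seq (fun l => (S y)^-1 * g (l ** y))) => [|l lr]; last first.
    by rewrite S_inv//; exact: rL.
  rewrite -mulr_sumr; apply/eqP; rewrite -(inj_eq (mulfI (lt0r_neq0 (S_gt0 y)))).
  by rewrite mulrA divff ?lt0r_neq0// mul1r mulr1 /S (@fsum_seq _ _ _ _ r).
Qed.

End Shift.

(** * The averaged function *)

(** Restricting the estimate to nonzero weights is essential for the uses below, where [tau i y] is
    known to lift [y] only there. *)
Lemma mean_dist (R : realType) (I : eqType) (r : seq I) (u A : I -> R) (X E : R) :
  (forall i, 0 <= u i) -> \sum_(i <- r) u i = 1 ->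
  (forall i, i \in r -> u i != 0 -> `|A i - X| <= E) ->
  `|\sum_(i <- r) u i * A i - X| <= E.
Proof.
move=> u0 u1 AX.
have -> : \sum_(i <- r) u i * A i - X = \sum_(i <- r) u i * (A i - X).
  under [RHS]eq_bigr do rewrite mulrBr.
  by rewrite sumrB -mulr_suml u1 mul1r.
rewrite (le_trans (ler_norm_sum _ _ _))// -[leRHS]mul1r -u1 mulr_suml !big_seq.
apply: ler_sum => i ir; rewrite normrM ger0_norm//.
have [->|ui] := eqVneq (u i) 0; first by rewrite !mul0r.
by rewrite ler_wpM2l// AX.
Qed.

Lemma meanD (R : realType) (I : Type) (r : seq I) (u A B : I -> R) :
  \sum_(i <- r) u i * A i + \sum_(i <- r) u i * B i = \sum_(i <- r) u i * (A i + B i).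
Proof. by rewrite -big_split; apply: eq_bigr => i _; rewrite mulrDr. Qed.

Lemma meanB (R : realType) (I : Type) (r : seq I) (u A B : I -> R) :
  \sum_(i <- r) u i * A i - \sum_(i <- r) u i * B i = \sum_(i <- r) u i * (A i - B i).
Proof. by rewrite -sumrB; apply: eq_bigr => i _; rewrite mulrBr. Qed.

(** This serves functions continuous only relative to a subset: [phi] on the kernel and the sections
    on the closures of the pieces. *)
Lemma cvg_within_comp (S T U : topologicalType) (A : set T) (f : T -> U) (h : S -> T) (x : S) :
  {within A, continuous f} -> h z @[z --> x] --> h x -> (\forall z \near x, A (h z)) ->
  f (h z) @[z --> x] --> f (h x).
Proof.
move=> /subspace_continuousP cf hx Ah V Vf.
have VA : nbhs (h x) [set z | A z -> V (f z)] := cf _ (nbhs_singleton Ah) V Vf.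
have h1 : \forall z \near x, A (h z) -> V (f (h z)) := hx _ VA.
have : \forall z \near x, V (f (h z)) by apply: filterS2 h1 Ah => z; exact.
exact.
Qed.

Lemma cvg_sum_seq (R : realType) (T : Type) (F : set_system T) {FF : Filter F}
    (I : eqType) (r : seq I) (f : I -> T -> R) (a : I -> R) :
  (forall i, i \in r -> f i x @[x --> F] --> a i) ->
  \sum_(i <- r) f i x @[x --> F] --> \sum_(i <- r) a i.
Proof.
elim: r => [|i r IH] h.
  by under eq_cvg do rewrite big_nil; rewrite big_nil; exact: cvg_cst.
under eq_cvg do rewrite big_cons; rewrite big_cons.
apply: cvgD; first by apply: h; exact: mem_head.
by apply: IH => j jr; apply: h; rewrite in_cons jr orbT.
Qed.

Section Average.
Variables (R : realType) (Gh : topologicalType).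
Variables (mulG : Gh -> Gh -> Gh) (invG : Gh -> Gh) (oneG : Gh).
Variables (Q : topologicalType) (mul : Q -> Q -> Q) (inv : Q -> Q) (one : Q).
Hypothesis tgG : is_topological_group mulG invG oneG.
Hypothesis tgQ : is_topological_group mul inv one.
Local Notation "x ** y" := (mul x y) (at level 40, left associativity).
Local Notation "x *! y" := (mulG x y) (at level 40, left associativity).
Let gQ := tg_group tgQ.
Let gG := tg_group tgG.
Variable q : Gh -> Q.
Hypothesis qM : is_hom mulG mul q.

Variables (I : choiceType) (Idx : set I) (W : I -> Q -> R) (tau : I -> Q -> Gh).
Hypothesis W0 : forall i y, 0 <= W i y.
Hypothesis Wfin : forall C, compact C -> exists r : seq I,
  [/\ uniq r, forall i, i \in r -> Idx i &
      forall i y, Idx i -> C y -> W i y != 0 -> i \in r].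
Hypothesis W1 : forall y, \sum_(i \in Idx) W i y = 1.
Hypothesis tauK : forall i y, Idx i -> W i y != 0 -> q (tau i y) = y.
Variable phi : Gh -> R.

Let qV x : q (invG x) = inv (q x). Proof. exact: (homV gG gQ qM). Qed.

Definition avg (x : Gh) (y : Q) : R :=
  \sum_(i \in Idx) W i y * (\sum_(j \in Idx) W j (y ** q x) *
    phi (tau i y *! x *! invG (tau j (y ** q x)))).

(** One list serves all points of [C], so averages based at different points can be compared term by
    term. *)
Lemma wsum_seq C : compact C -> exists r : seq I,
  [/\ forall i, i \in r -> Idx i, forall y, C y -> \sum_(i <- r) W i y = 1 &
  forall (F : I -> I -> R) y z, C y -> C z ->
    \sum_(i \in Idx) W i y * (\sum_(j \in Idx) W j z * F i j) =
    \sum_(i <- r) W i y * (\sum_(j <- r) W j z * F i j)].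
Proof.
move=> /Wfin[r [ur rI rP]]; exists r; split=> // [y Cy|F y z Cy Cz].
  by rewrite -(W1 y); apply/esym/fsum_seq => // i Ii; exact: rP.
rewrite (fsum_seq ur) => // [|i Ii]; last first.
  by rewrite mulf_eq0 negb_or => /andP[+ _]; exact: rP.
apply: eq_bigr => i _; congr (_ * _); apply: fsum_seq => // j Ij.
by rewrite mulf_eq0 negb_or => /andP[+ _]; exact: rP.
Qed.

Section Pointwise.
Variables D D' : R.
Hypothesis phiD : forall a b, q a = one -> q b = one ->
  `|phi (a *! b) - phi a - phi b| <= D.
Hypothesis phiD' : forall g a, q a = one -> `|phi (g *! a *! invG g) - phi a| <= D'.

Let lift_one x z z' s t : q s = z -> q t = z' -> z' = z ** q x ->
  q (s *! x *! invG t) = one.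
Proof. by move=> sz tz e; rewrite !qM qV sz tz e (gmulrV gQ). Qed.

Let cut x x' s t v : s *! (x *! x') *! invG v = (s *! x *! invG t) *! (t *! x' *! invG v).
Proof. by rewrite !(gmulA gG) (gmulKV gG). Qed.

Let conj_one g x : q x = one -> q (g *! x *! invG g) = one.
Proof. by move=> x1; rewrite !qM qV x1 (gmulr1 gQ) (gmulrV gQ). Qed.

(** For fixed lifts of [y], [y ** q x] and [y ** q x ** q x'] the arguments of [phi] are related by
    [cut], which gives the bound [D]. The three indices are then averaged one after another, a term
    lacking an index being constant in it. *)
Lemma avg_mul x x' y :
  `|avg (x *! x') y - avg x y - avg x' (y ** q x)| <= D.
Proof.
pose C := [set y] `|` ([set y ** q x] `|` [set y ** q x ** q x']).
have cC : compact C by do 2?apply: compactU; exact: compact_set1.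
have [r [rI r1 rE]] := wsum_seq cC.
have e : y ** q (x *! x') = y ** q x ** q x' by rewrite qM (gmulA gQ).
have Cy : C y by left.
have Cy' : C (y ** q x) by right; left.
have Cy'' : C (y ** q x ** q x') by right; right.
rewrite /avg ?e !rE// meanB.
apply: mean_dist => [i||i ir Wi]; [exact: W0|exact: r1|].
have flip (a b c : R) : `|a - b - c| = `|(b + c) - a|.
  by rewrite -normrN; congr `|_|; ring.
rewrite flip meanD.
apply: mean_dist => [j||j jr Wj]; [exact: W0|exact: r1|].
have flip' (a b c : R) : `|b + c - a| = `|a - c - b|.
  by rewrite -normrN; congr `|_|; ring.
rewrite flip' meanB.
apply: mean_dist => [k||k kr Wk]; [exact: W0|exact: r1|].
rewrite (cut _ _ _ (tau j (y ** q x))) addrAC; apply: phiD.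
  exact: (lift_one (tauK (rI _ ir) Wi) (tauK (rI _ jr) Wj)).
exact: (lift_one (tauK (rI _ jr) Wj) (tauK (rI _ kr) Wk)).
Qed.

(** Since [q x] is trivial, [tau i y] also serves as the middle lift. The first factor is then a
    conjugate of [x], whose replacement by [x] costs [D']. *)
Lemma avg_mul_kerl x x' y : q x = one ->
  `|avg (x *! x') y - phi x - avg x' y| <= D + D'.
Proof.
move=> x1.
pose C := [set y] `|` [set y ** q x'].
have cC : compact C by apply: compactU; exact: compact_set1.
have [r [rI r1 rE]] := wsum_seq cC.
have e : y ** q (x *! x') = y ** q x' by rewrite qM x1 (gmul1 gQ).
have Cy : C y by left.
have Cy' : C (y ** q x') by right.
rewrite /avg ?e !rE// addrAC meanB.
apply: mean_dist => [i||i ir Wi]; [exact: W0|exact: r1|rewrite meanB].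
apply: mean_dist => [j||j jr Wj]; [exact: W0|exact: r1|].
rewrite (cut _ _ _ (tau i y)).
have h1 := phiD (conj_one (tau i y) x1)
  (lift_one (tauK (rI _ ir) Wi) (tauK (rI _ jr) Wj) erefl).
have h2 := phiD' (tau i y) x1.
apply: le_trans (lerD h1 h2); apply: le_trans (ler_normD _ _).
by rewrite le_eqVlt; apply/orP; left; apply/eqP; congr `|_|; ring.
Qed.

(** Here the last lift is reused as the middle one, so the second factor is a conjugate of [x']. *)
Lemma avg_mul_kerr x x' y : q x' = one ->
  `|avg (x *! x') y - avg x y - phi x'| <= D + D'.
Proof.
move=> x1.
pose C := [set y] `|` [set y ** q x].
have cC : compact C by apply: compactU; exact: compact_set1.
have [r [rI r1 rE]] := wsum_seq cC.
have e : y ** q (x *! x') = y ** q x by rewrite qM x1 (gmulr1 gQ).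
have Cy : C y by left.
have Cy' : C (y ** q x) by right.
rewrite /avg ?e !rE// meanB.
apply: mean_dist => [i||i ir Wi]; [exact: W0|exact: r1|rewrite meanB].
apply: mean_dist => [j||j jr Wj]; [exact: W0|exact: r1|].
rewrite (cut _ _ _ (tau j (y ** q x))).
have h1 := phiD (lift_one (tauK (rI _ ir) Wi) (tauK (rI _ jr) Wj) erefl)
  (conj_one (tau j (y ** q x)) x1).
have h2 := phiD' (tau j (y ** q x)) x1.
apply: le_trans (lerD h1 h2); apply: le_trans (ler_normD _ _).
by rewrite le_eqVlt; apply/orP; left; apply/eqP; congr `|_|; ring.
Qed.

(** The path returns to [y], so the second average uses the lifts of the first in reverse order.
    After exchanging its sums, the two arguments multiply to a conjugate of [x *! x']. *)
Lemma avg_mul_ker x x' y : q (x *! x') = one ->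
  `|avg x y + avg x' (y ** q x) - phi (x *! x')| <= D + D'.
Proof.
move=> x1.
pose C := [set y] `|` [set y ** q x].
have cC : compact C by apply: compactU; exact: compact_set1.
have [r [rI r1 rE]] := wsum_seq cC.
have e : y ** q x ** q x' = y by rewrite -(gmulA gQ) -qM x1 (gmulr1 gQ).
have Cy : C y by left.
have Cy' : C (y ** q x) by right.
rewrite /avg ?e !rE//.
have -> : \sum_(j <- r) W j (y ** q x) * (\sum_(i <- r) W i y *
      phi (tau j (y ** q x) *! x' *! invG (tau i y))) =
    \sum_(i <- r) W i y * (\sum_(j <- r) W j (y ** q x) *
      phi (tau j (y ** q x) *! x' *! invG (tau i y))).
  under eq_bigr do rewrite mulr_sumr; under [RHS]eq_bigr do rewrite mulr_sumr.
  rewrite exchange_big/=; apply: eq_bigr => i _; apply: eq_bigr => j _; ring.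
rewrite meanD.
apply: mean_dist => [i||i ir Wi]; [exact: W0|exact: r1|rewrite meanD].
apply: mean_dist => [j||j jr Wj]; [exact: W0|exact: r1|].
have h1 := phiD (lift_one (tauK (rI _ ir) Wi) (tauK (rI _ jr) Wj) erefl)
  (lift_one (tauK (rI _ jr) Wj) (tauK (rI _ ir) Wi) (esym e)).
rewrite -(cut x x') in h1.
have h2 := phiD' (tau i y) x1.
apply: le_trans (lerD h1 h2).
rewrite -[X in _ <= X + _]normrN; apply: le_trans (ler_normD _ _).
by rewrite le_eqVlt; apply/orP; left; apply/eqP; congr `|_|; ring.
Qed.

(** Up to reindexing, moving [y] by [m] multiplies all lifts on the left by [s], hence conjugates
    every argument of [phi] by [s]. *)
Lemma avg_translate (m : Q) (s : Gh) (sg : I -> I) x y : set_bij Idx Idx sg ->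
  (forall i z, Idx i -> W i (m ** z) = W (sg i) z) ->
  (forall i z, Idx i -> tau i (m ** z) = s *! tau (sg i) z) ->
  `|avg x (m ** y) - avg x y| <= D'.
Proof.
move=> bsg Wsg tausg.
pose C := [set y] `|` [set y ** q x].
have cC : compact C by apply: compactU; exact: compact_set1.
have [r [rI r1 rE]] := wsum_seq cC.
have Cy : C y by left.
have Cy' : C (y ** q x) by right.
have -> : avg x (m ** y) = \sum_(i \in Idx) W i y * (\sum_(j \in Idx) W j (y ** q x) *
    phi (s *! (tau i y *! x *! invG (tau j (y ** q x))) *! invG s)).
  rewrite /avg [RHS](reindex_fsbig sg Idx Idx)//; apply: eq_fsbigr => i /[!inE] Ii.
  rewrite Wsg//; congr (_ * _).
  rewrite [RHS](reindex_fsbig sg Idx Idx)//; apply: eq_fsbigr => j /[!inE] Ij.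
  by rewrite -(gmulA gQ) Wsg// !tausg// (ginvM gG) !(gmulA gG).
rewrite /avg !rE// meanB -[X in `|X|]subr0.
apply: mean_dist => [i||i ir Wi]; [exact: W0|exact: r1|rewrite subr0 meanB].
rewrite -[X in `|X|]subr0.
apply: mean_dist => [j||j jr Wj]; [exact: W0|exact: r1|].
rewrite subr0; apply: phiD'.
exact: (lift_one (tauK (rI _ ir) Wi) (tauK (rI _ jr) Wj)).
Qed.

End Pointwise.

Hypothesis lcQ : locally_compact [set: Q].
Hypothesis phic : {within [set x | q x = one], continuous phi}.
Hypothesis Wc : forall i, Idx i -> continuous (W i).
Hypothesis tauc : forall i y, Idx i -> (\forall z \near y, W i z = 0) \/
  (tau i z @[z --> y] --> tau i y /\ \forall z \near y, q (tau i z) = z).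

(** Near [y] the sum is finite. In each term either a weight vanishes nearby, or both lifts are
    continuous and the argument of [phi] stays in the kernel. *)
Lemma avg_continuous x : continuous (avg x).
Proof.
move=> y; have [C [yC cC _]] := lc_nbhs lcQ y.
have cCx : compact (C `|` [set u ** v | u in C & v in [set q x]]).
  by apply: compactU => //; apply: (compact_gmul tgQ cC); exact: compact_set1.
have [r [rI _ rE]] := wsum_seq cCx.
have Cr z : C z -> avg x z = \sum_(i <- r) W i z * (\sum_(j <- r) W j (z ** q x) *
    phi (tau i z *! x *! invG (tau j (z ** q x)))).
  by move=> Cz; rewrite /avg rE//; [left|right; exists z => //; exists (q x)].
rewrite /continuous_at Cr; last exact: nbhs_singleton.
have near_shift (P : set Q) : (\forall z \near y ** q x, P z) ->
    \forall z \near y, P (z ** q x) by exact: (continuous_gmulr tgQ).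
apply: cvg_trans.
  by apply: near_eq_cvg; apply: filterS yC => z Cz; rewrite [RHS](Cr _ Cz); reflexivity.
apply: cvg_sum_seq => i /rI Ii.
under eq_cvg do rewrite mulr_sumr; rewrite mulr_sumr.
apply: cvg_sum_seq => j /rI Ij.
have cWj : W j (z ** q x) @[z --> y] --> W j (y ** q x).
  apply: (cvg_comp (mul^~ (q x)) (W j) _ (@Wc j Ij _)).
  exact: (continuous_gmulr tgQ).
have [Wi|[ti qi]] := tauc y Ii.
  rewrite (nbhs_singleton Wi) mul0r; apply: cvg_near_cst.
  by apply: filterS Wi => z ->; rewrite mul0r.
have [Wj|[tj qj]] := tauc (y ** q x) Ij.
  rewrite (nbhs_singleton Wj) mul0r mulr0; apply: cvg_near_cst.
  by apply: filterS (near_shift _ Wj) => z ->; rewrite mul0r mulr0.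
apply: cvgM; first exact: (@Wc i Ii).
apply: cvgM => //.
apply: (cvg_within_comp (h := fun z => tau i z *! x *! invG (tau j (z ** q x))) phic).
  apply: (cvg_gmul tgG); first by apply: (cvg_gmul tgG) => //; exact: cvg_cst.
  apply: (cvg_ginv tgG); apply: (cvg_comp (mul^~ (q x)) (tau j) _ tj).
  exact: (continuous_gmulr tgQ).
apply: filterS2 qi (near_shift _ qj) => z qiz qjz.
by rewrite /= !qM qV qiz qjz (gmulrV gQ).
Qed.
End Average.

(** * The local section *)

(** A finite form of the Baire property: either the first closed set contains [O], or removing it
    leaves a nonempty open set covered by the others. *)
Lemma closed_cover_interior (T : topologicalType) (I : eqType) (s : seq I)
    (F : I -> set T) (O : set T) :
  open O -> O !=set0 -> (forall i, closed (F i)) ->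
  (forall y, O y -> exists2 i, i \in s & F i y) ->
  exists i U, [/\ i \in s, open U, U !=set0 & U `<=` F i].
Proof.
move=> oO O0 cF; elim: s O oO O0 => [|i s IH] O oO [y Oy] Os.
  by have [] := Os _ Oy.
have [[z [Oz nFz]]|nz] := pselect (O `&` ~` F i !=set0).
  have oU : open (O `&` ~` F i) by apply: openI => //; exact: closed_openC.
  have Os' w : (O `&` ~` F i) w -> exists2 j, j \in s & F j w.
    move=> [Ow nFw]; have [j + Fj] := Os _ Ow.
    rewrite in_cons => /orP[/eqP ji|js]; last by exists j.
    by rewrite ji in Fj.
  have [|j [U [js oU' U0 UF]]] := IH _ oU _ Os'; first by exists z.
  by exists j, U; rewrite in_cons js orbT.
exists i, O; split => //; [exact: mem_head|by exists y|move=> w Ow].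
by apply: contrapT => nFw; apply: nz; exists w.
Qed.

(* The alternative holds because the bump is truncated at 1/2: its closed support
   then lies in [U]. *)
Lemma Cp_bump_near (R : realType) (Q : topologicalType) (a : Q) (U : set Q) :
  hausdorff_space Q -> locally_compact [set: Q] -> nbhs a U ->
  exists f : Q -> R, [/\ Cp f, 0 < f a &
    forall y, U y \/ \forall z \near y, f z = 0].
Proof.
move=> hQ lcQ aU; have [f [[cf [K cK Kf]] _ fa fU]] := Cc_bump R hQ lcQ aU.
exists (fun x => Num.max (f x - 1 / 2) 0); split.
- split; last by move=> x; rewrite le_max lexx orbT.
  split.
    have cf' : continuous (fun x => f x - 1 / 2).
      by move=> x; apply: cvgB; [exact: cf|exact: cvg_cst].
    by move=> x; exact: (continuous_max (cf' x) (@cvg_cst _ _ _ _ _)).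
  by exists K => // x /Kf ->; rewrite max_r//; lra.
- by rewrite fa lt_max; apply/orP; left; lra.
- move=> y; have [Uy|nUy] := pselect (U y); [by left|right].
  have fy : f y = 0 by apply/eqP; apply: contrapT => /negP/fU.
  have /cvgr_lt := cf y; rewrite fy => /(_ (1 / 2)) h.
  have : \forall z \near y, f z < 1 / 2 by apply: h; lra.
  by apply: filterS => z fz; rewrite max_r//; lra.
Qed.

Section LocalSection.
Variables (Gh : topologicalType) (mulG : Gh -> Gh -> Gh) (invG : Gh -> Gh) (oneG : Gh).
Variables (Q : topologicalType) (mulQ : Q -> Q -> Q) (invQ : Q -> Q) (oneQ : Q).
Hypothesis tgG : is_topological_group mulG invG oneG.
Hypothesis tgQ : is_topological_group mulQ invQ oneQ.
Hypothesis lcQ : locally_compact [set: Q].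
Local Notation "x ** y" := (mulQ x y) (at level 40, left associativity).
Local Notation "x *! y" := (mulG x y) (at level 40, left associativity).
Let gQ := tg_group tgQ.
Let gG := tg_group tgG.
Variable q : Gh -> Q.
Hypothesis qM : is_hom mulG mulQ q.
Hypothesis qsurj : forall y, exists x, q x = y.
Variables (Lam : set Q) (s1 : Q -> Gh).
Hypothesis Lfin : locally_finite_action mulQ Lam.
Hypothesis s1K : forall l, Lam l -> q (s1 l) = l.
Variables (B : set Q) (p : nat) (Bi : 'I_p -> set Q) (s2 : 'I_p -> Q -> Gh).
Hypothesis cB : compact (closure B).
Hypothesis LB : forall y, exists2 l, Lam l & B (l ** y).
Hypothesis BE : B = \bigcup_(i in [set: 'I_p]) Bi i.
Hypothesis s2c : forall i, {within closure (Bi i), continuous (s2 i)}.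
Hypothesis s2K : forall i x, closure (Bi i) x -> q (s2 i x) = x.

(* Near [oneQ], finitely many translates of the closed sets [closure (Bi i)]
   cover, so one of them has interior points. *)
Lemma local_section : exists (V : set Q) (s : Q -> Gh),
  [/\ open V, V oneQ, forall v, V v -> q (s v) = v &
      forall v, V v -> s z @[z --> v] --> s v].
Proof.
have [C [oC cC clC]] := lc_nbhs lcQ oneQ.
have [r [_ rL rP]] := Lfin (@compactU _ _ _ cC cB).
pose F (li : Q * 'I_p) := [set y | closure (Bi li.2) (li.1 ** y)].
have [li [N [lir oN [y1 Ny1] NF]]] : exists i U,
    [/\ i \in [seq (l, i) | l <- r, i <- enum 'I_p], open U, U !=set0 & U `<=` F i].
  apply: (@closed_cover_interior _ _ _ _ (interior C)).
  - exact: open_interior.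
  - by exists oneQ.
  - move=> [l i]; apply: (closed_comp (f := mulQ l)); last exact: closed_closure.
    by move=> x _; exact: (continuous_gmull tgQ).
  - move=> y /interior_subset Cy; have [l Ll Bl] := LB y.
    have [i _ Bil] : (\bigcup_(i in [set: 'I_p]) Bi i) (l ** y) by rewrite -BE.
    exists (l, i); last exact: subset_closure.
    apply/allpairsP; exists (l, i); split=> //=; last by rewrite mem_enum.
    by apply: (rP l y Ll); [left|right; exact: subset_closure].
move: li lir NF => [l i] /allpairsP[[l' i']/= [lr _ [? ?]]]; subst l' i' => NF.
have Ll := rL _ lr.
have [t tE] := qsurj y1.
(* The point [v ** y1] of [N] is moved by [l] into the closure of [Bi i], lifted by [s2 i], and
   brought back to [v] using [s1 l] and the lift [t] of [y1]. *)
exists (mulQ^~ y1 @^-1` N), (fun v => invG (s1 l) *! s2 i (l ** (v ** y1)) *! invG t).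
split.
- by apply: open_comp => // x _; exact: (continuous_gmulr tgQ).
- by rewrite /= (gmul1 gQ).
- move=> v /NF Fv; rewrite !qM !(homV gG gQ qM) s1K// s2K// tE.
  by rewrite (gKmul gQ) (gmulK gQ).
- move=> v /= Nv; apply: (cvg_gmul tgG); last exact: cvg_cst.
  apply: (cvg_gmul tgG); first exact: cvg_cst.
  apply: (cvg_within_comp (h := fun v => l ** (v ** y1)) (@s2c i)).
    apply: (cvg_gmul tgQ); first exact: cvg_cst.
    exact: (continuous_gmulr tgQ).
  have : nbhs v (mulQ^~ y1 @^-1` N).
    apply: open_nbhs_nbhs; split=> //.
    by apply: open_comp => // x _; exact: (continuous_gmulr tgQ).
  by apply: filterS => z /NF.
Qed.

End LocalSection.

(** * Construction of the extension *)

Lemma left_haar_normalized (R : realType) (Q : topologicalType)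
    (mul : Q -> Q -> Q) (inv : Q -> Q) (one : Q) (c : Q -> R) (a : Q) :
  is_topological_group mul inv one -> hausdorff_space Q -> locally_compact [set: Q] ->
  Cp c -> 0 < c a -> exists2 J, left_haar mul J & J c = 1.
Proof.
move=> tgQ hQ lcQ cp ca; have [J hJ] := left_haar_ex R tgQ hQ lcQ.
have Jc := haar_gt0 tgQ hJ cp ca.
have Jc0 : J c != 0 by rewrite gt_eqF.
have [JD JZ Jle JL _] := hJ.
exists (fun f => J f / J c); last by rewrite divff.
split.
- by move=> f g cf cg; rewrite JD// mulrDl.
- by move=> k f cf; rewrite JZ// mulrA.
- by move=> f g cf cg fg; rewrite ler_wpM2r ?invr_ge0 ?(ltW Jc)// Jle.
- by move=> b f cf; rewrite JL.
- by exists c; [case: cp|rewrite divff].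
Qed.

Unset Implicit Arguments. Set Strict Implicit.

Theorem theorem6p1 (R : realType)
  (Gh : topologicalType) (mulG : Gh -> Gh -> Gh) (invG : Gh -> Gh) (oneG : Gh)
  (Q : topologicalType) (mulQ : Q -> Q -> Q) (invQ : Q -> Q) (oneQ : Q)
  (G : set Gh) (q : Gh -> Q)
  (Lam : set Q) (s1 : Q -> Gh)
  (B : set Q) (p : nat) (Bi : 'I_p -> set Q) (s2 : 'I_p -> Q -> Gh) :
  is_topological_group mulG invG oneG ->
  is_topological_group mulQ invQ oneQ ->
  hausdorff_space Q -> locally_compact [set: Q] ->
  (* exact sequence 1 -> G -> Gh -> Q -> 1 of abstract groups *)
  is_hom mulG mulQ q -> (forall y, exists x, q x = y) ->
  G = [set x | q x = oneQ] ->
  (* Lam a discrete subgroup of Q with a homomorphic section s1 *)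
  is_subgroup mulQ invQ oneQ Lam -> discrete_subset Lam ->
  (forall l m, Lam l -> Lam m -> s1 (mulQ l m) = mulG (s1 l) (s1 m)) ->
  (forall l, Lam l -> q (s1 l) = l) ->
  (* B a relatively compact strict fundamental domain, finitely Borel-partitioned *)
  compact (closure B) -> strict_fundamental_domain mulQ Lam B ->
  B = \bigcup_(i in [set: 'I_p]) Bi i ->
  (forall i j, i != j -> Bi i `&` Bi j = set0) ->
  (forall i, borel_set (Bi i)) ->
  (forall i, {within closure (Bi i), continuous (s2 i)}) ->
  (forall i x, closure (Bi i) x -> q (s2 i x) = x) ->
  forall phi : Gh -> R,
    {within G, continuous phi} ->
    is_quasimorphism mulG G phi -> is_quasi_invariant mulG invG G phi ->
    exists phih : Gh -> R,
      [/\ is_quasimorphism mulG [set: Gh] phih,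
          (forall x, G x -> phih x = phi x) &
          defect mulG [set: Gh] phih <= defect mulG G phi + 3 * qi_defect mulG invG G phi].
Proof.
move=> tgG tgQ hQ lcQ qM qsurj GE LamG dLam s1M s1K cB fdB BE _ _ s2c s2K.
move=> phi phic [D0 phiD0] [D0' phiD0'].
have gQ := tg_group tgQ; have gG := tg_group tgG.
have q1 : q oneG = oneQ := hom1 gG gQ qM.
have qV x : q (invG x) = invQ (q x) := homV gG gQ qM x.
have [Lam1 LamM LamV] := LamG.
have Lfin := discrete_locally_finite tgQ LamG dLam.
set D := defect mulG G phi; set D' := qi_defect mulG invG G phi.
(* The existing bounds [D0] and [D0'] make the suprema [D] and [D'] genuine upper bounds rather than
   default values. *)
have phiD a b : q a = oneQ -> q b = oneQ -> `|phi (mulG a b) - phi a - phi b| <= D.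
  move=> qa qb; apply: sup_upper_bound.
    split; first by exists `|phi (mulG a b) - phi a - phi b|, a; rewrite ?GE//; exists b.
    by exists D0 => _ [x Gx [y Gy <-]]; exact: phiD0.
  by exists a; rewrite ?GE//; exists b.
have phiD' g a : q a = oneQ -> `|phi (mulG (mulG g a) (invG g)) - phi a| <= D'.
  move=> qa; apply: sup_upper_bound.
    split; first by exists `|phi (mulG (mulG g a) (invG g)) - phi a|, g => //; exists a; rewrite ?GE.
    by exists D0' => _ [x _ [y Gy <-]]; exact: phiD0'.
  by exists g => //; exists a; rewrite ?GE.
have D'0 : 0 <= D' by apply: le_trans (phiD' oneG oneG q1).
have LB y : exists2 l, Lam l & B (mulQ l y).
  by have [b [[Bb [l [Ll bE]]] _]] := fdB y; exists l; rewrite -?bE.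
have [V [s0 [oV V1 s0K s0c]]] := local_section tgG tgQ lcQ qM qsurj Lfin s1K cB LB BE s2c s2K.
have [psi [psip psi1 psiV]] :=
  Cp_bump_near R hQ lcQ (open_nbhs_nbhs (conj oV V1 : open_nbhs oneQ V)).
have psi0 x : 0 <= psi x by case: psip.
have cpsi : continuous psi by case: psip => -[].
have LcB y : exists2 l, Lam l & closure B (mulQ l y).
  by have [l Ll Bl] := LB y; exists l => //; exact: subset_closure.
have [A [S [[cS S0 Sinv] Wfin W1 [c [cp c_sum]]]]] :=
  weights_ex tgQ lcQ LamG Lfin psip psi1 cB LcB.
set Idx := weight_index Lam A in Wfin W1.
pose W (i : Q * Q) y := psi (mulQ (mulQ i.1 y) (invQ i.2)) / S y.
rewrite -/W in Wfin W1.
have [t tK] := choice qsurj.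
pose arg (i : Q * Q) y := mulQ (mulQ i.1 y) (invQ i.2).
have cvg_arg i y : arg i z @[z --> y] --> arg i y.
  apply: (cvg_gmul tgQ); last exact: cvg_cst.
  exact: (continuous_gmull tgQ).
(* With [i = (l, a)], [s0] lifts [l y a^-1] when this lies in [V]; the lifts [s1 l] and [t a] carry
   the result back over [y]. The lift [t] needs no continuity, as [a] does not vary with [y]. *)
pose tau (i : Q * Q) y := mulG (mulG (invG (s1 i.1)) (s0 (arg i y))) (t i.2).
have q_tau i y : Idx i -> V (arg i y) -> q (tau i y) = y.
  move=> [Li _] Vi; rewrite /tau !qM qV s1K// s0K// tK /arg.
  by rewrite (gmulA gQ) (gKmul gQ) (gmulKV gQ).
have W0 i y : 0 <= W i y by rewrite divr_ge0// ltW.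
have Wc i : Idx i -> continuous (W i).
  move=> _ y; apply: cvgM.
    exact: (cvg_comp (arg i) psi (cvg_arg i y) (cpsi _)).
  by apply: cvgV; [exact: lt0r_neq0|exact: cS].
have tauK i y : Idx i -> W i y != 0 -> q (tau i y) = y.
  move=> Ii Wi; apply: q_tau => //; have [//|/nbhs_singleton psi_eq0] := psiV (arg i y).
  by move: Wi; rewrite /W [psi _]psi_eq0 mul0r eqxx.
(* By [psiV], either [arg i y] lies in the open set [V], where [s0] is a continuous section, or
   [psi] vanishes near it. *)
have tauc i y : Idx i -> (\forall z \near y, W i z = 0) \/
    (tau i z @[z --> y] --> tau i y /\ \forall z \near y, q (tau i z) = z).
  move=> Ii; have [Vi|psi_near0] := psiV (arg i y).
    right; split.
      apply: (cvg_gmul tgG); last exact: cvg_cst.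
      apply: (cvg_gmul tgG); first exact: cvg_cst.
      exact: (cvg_comp (arg i) s0 (cvg_arg i y) (s0c _ Vi)).
    have : \forall z \near y, V (arg i z).
      by apply: cvg_arg; apply: open_nbhs_nbhs.
    by apply: filterS => z; exact: q_tau.
  left; have : \forall z \near y, psi (arg i z) = 0 := cvg_arg i y _ psi_near0.
  by apply: filterS => z psi_z; rewrite /W [psi _]psi_z mul0r.
pose f := avg mulG invG mulQ q Idx W tau phi.
have phicq : {within [set x | q x = oneQ], continuous phi} by rewrite -GE.
have cf x : continuous (f x).
  exact: (avg_continuous tgG tgQ qM Wfin W1 lcQ phicq Wc tauc).
(* Moving [y] by [l] sends the index [(m, a)] to [(m l, a)]: the weights agree by invariance of [S],
   and the lifts differ by the left factor [s1 l] because [s1] is multiplicative. *)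
have fL l x y : Lam l -> `|f x (mulQ l y) - f x y| <= D'.
  move=> Ll; apply: (avg_translate tgG tgQ qM W0 Wfin W1 tauK phiD'
    (s := s1 l) (sg := fun i => (mulQ i.1 l, i.2))).
  - split=> [[m a] [/= Lm aA]|[m a] [m' a'] _ _ [/(gmulIr gQ) -> ->]//|[m a] [/= Lm aA]].
      by split=> //=; exact: LamM.
    exists (mulQ m (invQ l), a); last by rewrite /= (gmulKV gQ).
    by split=> //=; apply: LamM => //; exact: LamV.
  - by move=> [m a] z _; rewrite /W /= Sinv// (gmulA gQ).
  - move=> [m a] z [/= Lm _]; rewrite /tau /arg /= s1M// (ginvM gG) !(gmulA gG) (gmulrV gG).
    by rewrite (gmul1 gG) (gmulA gQ).
have [a ca] := weight_pos oneQ cp c_sum.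
have [J hJ Jc] := left_haar_normalized tgQ hQ lcQ cp ca.
have c0 x : 0 <= c x by case: cp.
have cc : Cc c by case: cp.
have [JD JZ _ _ _] := hJ.
have Ccu (u : Q -> R) : continuous u -> Cc (fun y => c y * u y).
  move=> cu; rewrite (_ : (fun y => _) = (fun y => u y * c y)); first exact: CcMl.
  by apply/funext => y; rewrite mulrC.
(* As [J c = 1], [M] is a mean: it fixes constants and preserves uniform bounds. *)
pose M (u : Q -> R) := J (fun y => c y * u y).
have Mdist (u v : Q -> R) E : continuous u -> continuous v -> (forall y, `|u y - v y| <= E) ->
    `|M u - M v| <= E.
  move=> cu cv uv; rewrite -[leRHS]mulr1 -Jc -JZ//.
  apply: (haar_dist hJ); [exact: Ccu|exact: Ccu|exact: CcZ|move=> y].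
  by rewrite -mulrBr normrM ger0_norm// mulrC ler_wpM2r.
have MD (u v : Q -> R) : continuous u -> continuous v -> M (fun y => u y + v y) = M u + M v.
  move=> cu cv; rewrite /M -JD; [|exact: Ccu|exact: Ccu].
  by congr J; apply/funext => y; rewrite mulrDr.
have Mk k : M (fun=> k) = k.
  rewrite /M -[RHS]mulr1 -Jc -JZ//.
  by congr J; apply/funext => y; rewrite mulrC.
have cst k : continuous (fun _ : Q => k : R) by move=> y; exact: cvg_cst.
have cD (u v : Q -> R) : continuous u -> continuous v -> continuous (fun y : Q => u y + v y : R).
  by move=> cu cv y; apply: cvgD; [exact: cu|exact: cv].
have csh x g : continuous (fun y => f x (mulQ y g)).
  move=> y; apply: (cvg_comp (mulQ^~ g) (f x) _ (cf x _)).
  exact: (continuous_gmulr tgQ).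
have Mshift x g : `|M (fun y => f x (mulQ y g)) - M (f x)| <= D'.
  rewrite -[leRHS]mulr1 -Jc.
  exact: (haar_shift tgQ hQ lcQ LamG Lfin g cp c_sum hJ (cf x) (fun l y => fL l x y)).
pose phih x := if pselect (q x = oneQ) then phi x else M (f x).
have phih1 x : q x = oneQ -> phih x = phi x by rewrite /phih; case: pselect.
have phihN x : q x <> oneQ -> phih x = M (f x) by rewrite /phih; case: pselect.
have phihD x y : `|phih (mulG x y) - phih x - phih y| <= D + 3 * D'.
  have [qx|qx] := pselect (q x = oneQ).
    have [qy|qy] := pselect (q y = oneQ).
      rewrite !phih1// ?qM ?qx ?qy ?(gmul1 gQ)//.
      by apply: (le_trans (phiD _ _ qx qy)); lra.
    rewrite (phih1 x)// (phihN y)// phihN ?qM ?qx ?(gmul1 gQ)//.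
    have : `|M (f (mulG x y)) - M (fun z => phi x + f y z)| <= D + D'.
      apply: Mdist => [||z]; [exact: cf|by apply: cD; [exact: cst|exact: cf]|].
      rewrite opprD addrA.
      exact: (avg_mul_kerl tgG tgQ qM W0 Wfin W1 tauK phiD phiD').
    rewrite (MD _ _ (cst _) (cf _)) Mk.
    by rewrite opprD addrA => /le_trans; apply; lra.
  have [qy|qy] := pselect (q y = oneQ).
    rewrite (phihN x)// (phih1 y)// phihN ?qM ?qy ?(gmulr1 gQ)//.
    have : `|M (f (mulG x y)) - M (fun z => f x z + phi y)| <= D + D'.
      apply: Mdist => [||z]; [exact: cf|by apply: cD; [exact: cf|exact: cst]|].
      rewrite opprD addrA.
      exact: (avg_mul_kerr tgG tgQ qM W0 Wfin W1 tauK phiD phiD').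
    rewrite (MD _ _ (cf _) (cst _)) Mk.
    by rewrite opprD addrA => /le_trans; apply; lra.
  (* Neither factor lies in the kernel from here on, and undoing the shift of [f y] by [q x] costs
     [D']. The total is [D + 2 * D'] if the product lies in the kernel and [D + D'] otherwise. *)
  have sh := Mshift y (q x).
  rewrite (phihN x)// (phihN y)//.
  have [qxy|qxy] := pselect (q (mulG x y) = oneQ).
    rewrite phih1//.
    have : `|M (fun z => f x z + f y (mulQ z (q x))) - M (fun=> phi (mulG x y))| <= D + D'.
      apply: Mdist => [||z]; [by apply: cD; [exact: cf|exact: csh]|exact: cst|].
      exact: (avg_mul_ker tgG tgQ qM W0 Wfin W1 tauK phiD phiD').
    rewrite (MD _ _ (cf _) (csh _ _)) Mk.
    move: sh; rewrite !ler_norml => /andP[? ?] /andP[? ?]; apply/andP; split; lra.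
  rewrite phihN//.
  have : `|M (f (mulG x y)) - M (fun z => f x z + f y (mulQ z (q x)))| <= D.
    apply: Mdist => [||z]; [exact: cf|by apply: cD; [exact: cf|exact: csh]|].
    rewrite opprD addrA.
    exact: (avg_mul tgG tgQ qM W0 Wfin W1 tauK phiD).
  rewrite (MD _ _ (cf _) (csh _ _)).
  move: sh; rewrite !ler_norml => /andP[? ?] /andP[? ?]; apply/andP; split; lra.
exists phih; split.
- by exists (D + 3 * D') => x y _ _.
- by move=> x; rewrite GE; exact: phih1.
- apply: ge_sup; first by exists `|phih (mulG oneG oneG) - phih oneG - phih oneG|, oneG => //; exists oneG.
  by move=> _ [x _ [y _ <-]].
Qed.
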